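(* Let $p\ge1$ be an integer, $G$ a nonvanishing log-harmonic mapping in $\mathbb{D}$, $\lambda_1,\dots,\lambda_p$ complex constants, $f$ and $h$ nonvanishing constant functions in $\mathbb{D}$, and $F(z)=f(z)h(\overline z)\prod_{k=1}^{p}G(z)^{\lambda_k|z|^{2(k-1)}}$ for $z\in\mathbb{D}$. Suppose that $\log F$ is univalent, that $\log G$ is univalent and convex, and that $\mathcal{L}[\log G(z)]\neq0$ and $\sum_{k=1}^{p}\lambda_k|z|^{2(k-1)}\neq0$ for $z\in\mathbb{D}\setminus\{0\}$. Then $\log F$ maps the subdisk $\mathbb{D}_r=\{z:|z|<r\}$ onto a convex region for every $r\in(0,\sqrt2-1]$.
   Context: $\mathbb{D}=\{z\in\mathbb{C}:|z|<1\}$; $\mathcal{L}=z\frac{\partial}{\partial z}-\overline{z}\frac{\partial}{\partial\overline{z}}$; univalent means injective. A univalent polyharmonic (in particular, harmonic) mapping $\Phi$ in $\mathbb{D}$ with $\frac{\partial}{\partial t}\Phi(re^{it})\neq0$ whenever $0<r<1$ is called convex if the curve $t\mapsto\Phi(re^{it})$ is convex for each $0<r<1$; in other words, if $\frac{\partial}{\partial t}\left(\arg\frac{\partial}{\partial t}\Phi(re^{it})\right)>0$ for all $z=re^{it}\in\mathbb{D}\setminus\{0\}$. A log-harmonic mapping $G$ in $\mathbb{D}$ is a solution of $\overline{G_{\overline z}}/\overline{G}=a\,G_z/G$ for some analytic function $a$; a nonvanishing such $G$ can be expressed as $G=g_1\overline{g_2}$ with $g_1,g_2$ (nonvanishing)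 analytic in $\mathbb{D}$, so $\log G=\log g_1+\overline{\log g_2}$, for fixed analytic branches of the logarithms, is harmonic in $\mathbb{D}$. Powers are defined by $G^{w}=\exp(w\log G)$ and, correspondingly, $\log F(z)=\log f+\log h+\Big(\sum_{k=1}^{p}\lambda_k|z|^{2(k-1)}\Big)\log G(z)$, where $\log f,\log h$ are fixed constants. *)

(* Defs.v *)
From Stdlib Require Import Reals List Lia.
From Coquelicot Require Import Coquelicot.
Import ListNotations.

Open Scope R_scope.

Definition disk (r : R) (z : C) : Prop := Cmod z < r.

Definition univalent (f : C -> C) : Prop :=
  forall z w, disk 1 z -> disk 1 w -> f z = f w -> z = w.

Definition nonvanishing (f : C -> C) : Prop :=
  forall z, disk 1 z -> f z <> RtoC 0.

Definition constant_function (f : C -> C) : Prop :=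
  exists c : C, forall z, disk 1 z -> f z = c.

(* Over [C_AbsRing] the derivative is the complex one. *)
Definition analytic (f : C -> C) : Prop :=
  forall z, disk 1 z -> @ex_derive C_AbsRing C_NormedModule f z.

(* Real (Frechet) differentiability in (x, y), where z = x + iy. *)
Definition real_differentiable (f : C -> C) (z : C) : Prop :=
  @ex_filterdiff R_AbsRing C_R_NormedModule C_R_NormedModule f (locally z).

Definition Dx (f : C -> C) (z : C) : C :=
  (Derive (fun x => Re (f (x, Im z))) (Re z),
   Derive (fun x => Im (f (x, Im z))) (Re z)).

Definition Dy (f : C -> C) (z : C) : C :=
  (Derive (fun y => Re (f (Re z, y))) (Im z),
   Derive (fun y => Im (f (Re z, y))) (Im z)).

(* The Wirtinger derivatives; [Derive] is total, so these are meaningful only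
   where the partial derivatives exist. *)
Definition Dz (f : C -> C) (z : C) : C :=
  ((Dx f z - Ci * Dy f z) / RtoC 2)%C.

Definition Dzbar (f : C -> C) (z : C) : C :=
  ((Dx f z + Ci * Dy f z) / RtoC 2)%C.

Definition Lop (f : C -> C) (z : C) : C :=
  (z * Dz f z - Cconj z * Dzbar f z)%C.

Definition cis (t : R) : C := (cos t, sin t).

Definition Cexp (z : C) : C := (RtoC (exp (Re z)) * cis (Im z))%C.

(* The equation is written in quotient form, which is meaningful because it is
   only used for nonvanishing G.  The second dilatation a is not required to
   satisfy |a| < 1. *)
Definition log_harmonic (G : C -> C) : Prop :=
  exists a : C -> C, analytic a /\
    forall z, disk 1 z ->
      real_differentiable G z /\
      (Cconj (Dzbar G z) / Cconj (G z) = a z * (Dz G z / G z))%C.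

(* logG = log g1 + conj (log g2), where G = g1 * conj g2 with g1, g2 analytic
   and nonvanishing, for fixed analytic branches l1 of log g1 and l2 of log g2. *)
Definition log_branch (G logG : C -> C) : Prop :=
  exists g1 g2 l1 l2 : C -> C,
    analytic g1 /\ analytic g2 /\ nonvanishing g1 /\ nonvanishing g2 /\
    analytic l1 /\ analytic l2 /\
    forall z, disk 1 z ->
      G z = (g1 z * Cconj (g2 z))%C /\
      Cexp (l1 z) = g1 z /\ Cexp (l2 z) = g2 z /\
      logG z = (l1 z + Cconj (l2 z))%C.

(* [theta] is a differentiable branch of arg (d/dt Phi(r e^{it})), with [v t]
   the derivative d/dt Phi(r e^{it}), which is required to exist and be nonzero. *)
Definition convex_mapping (Phi : C -> C) : Prop :=
  forall r, 0 < r < 1 ->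
    exists (v : R -> C) (theta : R -> R), forall t : R,
      @is_derive R_AbsRing C_R_NormedModule
        (fun s => Phi (RtoC r * cis s)%C) t (v t) /\
      v t <> RtoC 0 /\
      v t = (RtoC (Cmod (v t)) * cis (theta t))%C /\
      ex_derive theta t /\ 0 < Derive theta t.

(* sum_{k=1}^p lambda_k |z|^{2(k-1)} *)
Definition Lambda (p : nat) (lambda : nat -> C) (z : C) : C :=
  sum_n_m (fun k => (lambda k * RtoC (Cmod z ^ (2 * (k - 1))))%C) 1 p.

(* The power G(z)^w relative to the branch [logG]. *)
Definition Gpow (logG : C -> C) (z w : C) : C := Cexp (w * logG z)%C.

(* prod_{k=1}^p u_k *)
Definition Cprod (p : nat) (u : nat -> C) : C :=
  fold_right (fun k acc => (u k * acc)%C) (RtoC 1) (seq 1 p).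

Definition image (f : C -> C) (S : C -> Prop) (w : C) : Prop :=
  exists z, S z /\ f z = w.

Definition convex_set (S : C -> Prop) : Prop :=
  forall w1 w2 s, S w1 -> S w2 -> 0 <= s <= 1 ->
    S (RtoC (1 - s) * w1 + RtoC s * w2)%C.

(* Connectedness of the region is implied by convexity. *)
Definition convex_region (S : C -> Prop) : Prop :=
  (exists w, S w) /\ @open C_UniformSpace S /\ convex_set S.

Lemma Cexp_plus (z w : C) : Cexp (z + w)%C = (Cexp z * Cexp w)%C.
Proof.
  destruct z as [a b], w as [c d].
  unfold Cexp, cis, Cmult, Cplus, RtoC; simpl.
  rewrite exp_plus, cos_plus, sin_plus.
  f_equal; ring.
Qed.

Lemma Cexp_0 : Cexp (RtoC 0) = RtoC 1.
Proof.
  unfold Cexp, cis, Cmult, RtoC; simpl.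
  rewrite exp_0, cos_0, sin_0. f_equal; ring.
Qed.

Lemma Cprod_Gpow (p : nat) (lambda : nat -> C) (logG : C -> C) (z : C) :
  Cprod p (fun k => Gpow logG z (lambda k * RtoC (Cmod z ^ (2 * (k - 1)))))%C
  = Cexp (Lambda p lambda z * logG z)%C.
Proof.
  unfold Cprod, Gpow, Lambda, sum_n_m, Iter.iter_nat.
  set (u := fun k : nat => (lambda k * RtoC (Cmod z ^ (2 * (k - 1))))%C).
  change (fold_right (fun k acc => (Cexp (u k * logG z) * acc)%C) (RtoC 1)
            (seq 1 p)
          = Cexp (sum_n_m u 1 p * logG z)%C).
  assert (H : forall n m, fold_right
     (fun k acc => (Cexp (u k * logG z) * acc)%C) (RtoC 1) (seq m n)
     = Cexp (sum_n_m u m (m + n - 1) * logG z)%C \/ m = 0%nat).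
  { induction n as [|n IH]; intros m; destruct m as [|m]; auto; left.
    - rewrite sum_n_m_zero by lia. simpl.
      replace (zero * logG z)%C with (RtoC 0).
      + now rewrite Cexp_0.
      + change (@zero C_AbelianMonoid) with (RtoC 0). ring.
    - destruct (IH (S (S m))) as [E|E]; [|discriminate].
      simpl fold_right. simpl in E. rewrite E.
      rewrite (sum_Sn_m u (S m)) by lia.
      rewrite <- Cexp_plus. f_equal.
      replace (S m + S n - 1)%nat with (S (m + n)) by lia.
      replace (m + n - 0)%nat with (m + n)%nat by lia.
      change (@plus C_AbelianMonoid) with Cplus.
      rewrite <- Cmult_plus_distr_r. reflexivity. }
  destruct (H p 1%nat) as [E|E]; [|discriminate].
  rewrite E. do 3 f_equal. lia.
Qed.

Lemma exp_logF (p : nat) (lambda : nat -> C) (logG : C -> C)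
  (f0 h0 logf logh z : C) :
  Cexp logf = f0 -> Cexp logh = h0 ->
  Cexp (logf + logh + Lambda p lambda z * logG z)%C =
  (f0 * h0 *
   Cprod p (fun k => Gpow logG z (lambda k * RtoC (Cmod z ^ (2 * (k - 1))))))%C.
Proof.
  intros Hf Hh. now rewrite Cprod_Gpow, !Cexp_plus, Hf, Hh.
Qed.

(* Main.v *)
(** The factor [Lambda] depends on [|z|] only, so on the circle [|z| = r] the map
    [logF] is [k + c * logG] with constants [k] and [c <> 0]: it sends the circle to
    a simple closed curve [Gamma] whose tangent angle increases.  By Hopf's
    Umlaufsatz the total turning of [Gamma] is [2 PI], so [Gamma] lies to the left
    of all its tangents, and the points strictly to the left of all tangents form
    an open convex set [Omega].  Only continuity and injectivity of [logF] on the
    closed disk are needed to see that it maps the open disk onto [Omega]: the image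
    covers [Omega] because [Gamma] winds around each point of it, and the image
    cannot leave [Omega], since on a segment in the disk the first exit point
    would be mapped to [Gamma], the image of the circle. *)

Require Import Defs.
From Stdlib Require Import Reals Lra Lia Ranalysis5 Classical IndefiniteDescription.
From Coquelicot Require Import Coquelicot.

Open Scope R_scope.

(** * Continuous arguments on rectangles *)

(** The Jordan curve theorem and winding numbers are avoided. All angle counts follow one pattern:
    an angle confined to a half-plane varies by at most [PI], and a continuous quantity with values
    in the multiples of [2 PI] is constant. The only topological tool behind this is a continuous
    argument on a rectangle, which serves twice: for the secants in the Umlaufsatz, and for the
    images of the circles of radius at most [r] seen from a point of [Omega]. Convexity shortens the
    Umlaufsatz: since the tangent angle increases, the total turning is a positive multiple of
    [2 PI], and it is enough to bound it from above. Strict increase matters again later, because it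
    makes each tangent touch [Gamma] at a single point; a zero of the distance to the tangents is
    therefore a point of [Gamma], to which injectivity applies. The obstacle is that the affine
    relation between [logF] and [logG] changes from circle to circle, so convexity of [logG] gives
    information on one curve at a time and the interior must be handled by topology. *)

Lemma continuous_Rplus {U : UniformSpace} (f g : U -> R) (p : U) :
  continuous f p -> continuous g p -> continuous (fun q => f q + g q) p.
Proof. apply (@continuous_plus U R_AbsRing R_NormedModule f g p). Qed.

Lemma continuous_Rmult {U : UniformSpace} (f g : U -> R) (p : U) :
  continuous f p -> continuous g p -> continuous (fun q => f q * g q) p.
Proof. apply (@continuous_mult U R_AbsRing f g p). Qed.

Lemma continuous_Rminus {U : UniformSpace} (f g : U -> R) (p : U) :
  continuous f p -> continuous g p -> continuous (fun q => f q - g q) p.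
Proof. apply (@continuous_minus U R_AbsRing R_NormedModule f g p). Qed.

Lemma continuous_R_comp {U : UniformSpace} (f : U -> R) (g : R -> R) (p : U) :
  continuous f p -> continuity_pt g (f p) -> continuous (fun q => g (f q)) p.
Proof.
  intros Hf Hg. apply (continuous_comp f g); [exact Hf|].
  now apply continuity_pt_filterlim.
Qed.

Lemma continuous_Rpair {U : UniformSpace} (f g : U -> R) (p : U) :
  continuous f p -> continuous g p ->
  continuous (fun q => (f q, g q) : R * R) p.
Proof.
  intros Hf Hg. apply (continuous_comp_2 f g (fun u v => (u, v))); auto.
  apply (continuous_ext (fun z => z)); [now intros []|]. apply continuous_id.
Qed.

Lemma continuous_Rdiv {U : UniformSpace} (f g : U -> R) (p : U) :
  continuous f p -> continuous g p -> g p <> 0 ->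
  continuous (fun q => f q / g q) p.
Proof.
  intros Hf Hg H. apply continuous_Rmult; [exact Hf|].
  apply (continuous_R_comp g Rinv); [exact Hg|].
  apply (continuity_pt_inv id); [|exact H]. apply derivable_continuous, derivable_id.
Qed.

Lemma unit_vector_angle (u v : R) :
  u ^ 2 + v ^ 2 = 1 -> exists alpha, u = cos alpha /\ v = sin alpha.
Proof.
  intros H. assert (-1 <= u <= 1) by nra.
  assert (Hs : sin (acos u) = Rabs v).
  { rewrite sin_acos by assumption. rewrite <- sqrt_Rsqr_abs. f_equal. unfold Rsqr. lra. }
  destruct (Rle_dec 0 v) as [Hv|Hv].
  - exists (acos u). rewrite cos_acos, Hs, Rabs_pos_eq by lra. auto.
  - exists (- acos u). rewrite cos_neg, sin_neg, cos_acos, Hs, Rabs_left by lra.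
    split; lra.
Qed.

Lemma atan_quotient (u v : R) :
  0 < u -> u ^ 2 + v ^ 2 = 1 -> cos (atan (v / u)) = u /\ sin (atan (v / u)) = v.
Proof.
  intros Hu H. rewrite cos_atan, sin_atan.
  assert (E : sqrt (1 + (v / u) ^ 2) = / u).
  { apply sqrt_lem_1.
    - assert (0 <= (v / u) ^ 2) by apply pow2_ge_0. lra.
    - left; now apply Rinv_0_lt_compat.
    - replace (1 + (v / u) ^ 2) with ((u ^ 2 + v ^ 2) * (/ u * / u)) by (field; lra).
      rewrite H; ring. }
  unfold Rsqr. replace (v / u * (v / u)) with ((v / u) ^ 2) by ring.
  rewrite E. split; field; lra.
Qed.

Definition in_rect (a b c d : R) (p : R * R) : Prop :=
  a <= fst p <= b /\ c <= snd p <= d.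

Lemma uniform_continuity_rect (f : R * R -> R) (a b c d : R) :
  (forall p, in_rect a b c d p -> continuous f p) ->
  forall eps : posreal, exists delta : posreal, forall p q,
    in_rect a b c d p -> in_rect a b c d q ->
    Rabs (fst q - fst p) < delta -> Rabs (snd q - snd p) < delta ->
    Rabs (f q - f p) < eps.
Proof.
  intros Hf eps.
  destruct (uniform_continuity_2d (fun u v => f (u, v)) a b c d) with (eps := eps)
    as [delta Hd].
  - intros u v Hu Hv. apply continuity_2d_pt_filterlim. simpl.
    apply (filterlim_ext f); [now intros []|]. now apply (Hf (u, v)).
  - exists delta. intros [p1 p2] [q1 q2] [Hp1 Hp2] [Hq1 Hq2] H1 H2. simpl in *. now apply Hd.
Qed.

(* Moving from the corner towards [p] in [N] small steps, the argument at [p] is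
   a sum of [N] arctangents, hence continuous; no gluing of local branches is needed. *)
Lemma continuous_argument_unit (f g : R * R -> R) (a b c d : R) :
  a <= b -> c <= d ->
  (forall p, in_rect a b c d p ->
     continuous f p /\ continuous g p /\ f p ^ 2 + g p ^ 2 = 1) ->
  exists A : R * R -> R, forall p, in_rect a b c d p ->
    continuous A p /\ f p = cos (A p) /\ g p = sin (A p).
Proof.
  intros Hab Hcd H.
  assert (h2 : 0 < 1 / 2) by lra.
  destruct (uniform_continuity_rect f a b c d) with (eps := mkposreal _ h2) as [d1 Hd1].
  { intros p Hp. now apply H. }
  destruct (uniform_continuity_rect g a b c d) with (eps := mkposreal _ h2) as [d2 Hd2].
  { intros p Hp. now apply H. }
  simpl in Hd1, Hd2.
  set (dl := Rmin d1 d2).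
  assert (Hdl : 0 < dl) by (apply Rmin_pos; apply cond_pos).
  (* The sum of the two side lengths bounds both of them, so with [S n] steps each coordinate moves
     by less than [dl] per step. *)
  destruct (nfloor_ex (((b - a) + (d - c)) / dl)) as [n Hn].
  { apply Rdiv_le_0_compat; lra. }
  assert (HN : 0 < INR (S n)) by (apply lt_0_INR; lia).
  assert (HNd : (b - a) + (d - c) < INR (S n) * dl).
  { rewrite S_INR. apply Rmult_lt_reg_r with (/ dl); [now apply Rinv_0_lt_compat|].
    rewrite Rmult_assoc, Rinv_r, Rmult_1_r by lra. apply Hn. }
  set (sc := fun (i : nat) (p : R * R) =>
    (a + INR i / INR (S n) * (fst p - a), c + INR i / INR (S n) * (snd p - c)) : R * R).
  assert (Hsc : forall i p, (i <= S n)%nat -> in_rect a b c d p -> in_rect a b c d (sc i p)).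
  { intros i p Hi [Hp1 Hp2]. unfold in_rect, sc; cbn [fst snd].
    assert (Ht : 0 <= INR i / INR (S n) <= 1).
    { split; [apply Rdiv_le_0_compat; [apply pos_INR|lra]|].
      apply Rmult_le_reg_r with (INR (S n)); [lra|].
      unfold Rdiv; rewrite Rmult_assoc, Rinv_l, Rmult_1_r, Rmult_1_l by lra.
      now apply le_INR. }
    set (t := INR i / INR (S n)) in *.
    assert (Hu : forall u, 0 <= u -> 0 <= t * u <= u) by (intros u Hu; nra).
    destruct (Hu (fst p - a)); [lra|]. destruct (Hu (snd p - c)); [lra|].  split; lra. }
  assert (Hcs : forall i p, continuous (sc i) p).
  { intros i [p1 p2]. apply continuous_Rpair.
    - apply continuous_Rplus; [apply continuous_const|].
      apply continuous_Rmult; [apply continuous_const|].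
      apply continuous_Rminus; [apply continuous_fst|apply continuous_const].
    - apply continuous_Rplus; [apply continuous_const|].
      apply continuous_Rmult; [apply continuous_const|].
      apply continuous_Rminus; [apply continuous_snd|apply continuous_const]. }
  assert (Hstep : forall i p, (i < S n)%nat -> in_rect a b c d p ->
    Rabs (f (sc (S i) p) - f (sc i p)) < 1 / 2 /\
    Rabs (g (sc (S i) p) - g (sc i p)) < 1 / 2).
  { intros i p Hi Hp.
    assert (E : forall u, INR (S i) / INR (S n) * u - INR i / INR (S n) * u = u / INR (S n)).
    { intros u. rewrite (S_INR i). field. lra. }
    assert (B : forall u, 0 <= u <= (b - a) + (d - c) -> Rabs (u / INR (S n)) < dl).
    { intros u Hu. rewrite Rabs_pos_eq by (apply Rdiv_le_0_compat; lra).
      apply Rmult_lt_reg_r with (INR (S n)); [lra|].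
      unfold Rdiv; rewrite Rmult_assoc, Rinv_l by lra. lra. }
    destruct Hp as [Hp1 Hp2].
    assert (Hp : in_rect a b c d p) by (split; assumption).
    assert (D1 : Rabs (fst (sc (S i) p) - fst (sc i p)) < dl).
    { unfold sc; cbn [fst snd]. replace (_ - _) with ((fst p - a) / INR (S n)) by (rewrite <- E; ring).
      apply B; lra. }
    assert (D2 : Rabs (snd (sc (S i) p) - snd (sc i p)) < dl).
    { unfold sc; cbn [fst snd]. replace (_ - _) with ((snd p - c) / INR (S n)) by (rewrite <- E; ring).
      apply B; lra. }
    assert (dl <= d1) by apply Rmin_l. assert (dl <= d2) by apply Rmin_r.
    split; [apply Hd1|apply Hd2]; try lra; apply Hsc; auto; lia. }
  assert (Hind : forall i, (i <= S n)%nat -> exists A : R * R -> R,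
    forall p, in_rect a b c d p ->
      continuous A p /\ f (sc i p) = cos (A p) /\ g (sc i p) = sin (A p)).
  { induction i as [|i IH]; intros Hi.
    - assert (E : forall p, sc 0%nat p = (a, c)).
      { intros p. unfold sc. change (INR 0) with 0. f_equal; field; lra. }
      destruct (unit_vector_angle (f (a, c)) (g (a, c))) as [al [Hc Hs]].
      { apply H. split; simpl; lra. }
      exists (fun _ => al). intros p Hp. rewrite E. split; [apply continuous_const|auto].
    - destruct IH as [A HA]; [lia|].
      (* [Q] and [P] are the cosine and the sine of the angle between two successive unit
         vectors. *)
      set (Q := fun p => f (sc i p) * f (sc (S i) p) + g (sc i p) * g (sc (S i) p)).
      set (P := fun p => f (sc i p) * g (sc (S i) p) - g (sc i p) * f (sc (S i) p)).
      exists (fun p => A p + atan (P p / Q p)).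
      intros p Hp. destruct (HA p Hp) as (HcA & Hfi & Hgi).
      destruct (H (sc i p)) as (Hf1 & Hg1 & Hu1); [apply Hsc; [lia|auto]|].
      destruct (H (sc (S i) p)) as (Hf2 & Hg2 & Hu2); [apply Hsc; [lia|auto]|].
      destruct (Hstep i p) as [S1 S2]; [lia|auto|].
      (* For unit vectors the inner product is 1 minus half the squared distance; coordinates
         differing by less than 1/2 make it larger than 3/4. *)
      assert (HQ : 0 < Q p).
      { unfold Q. apply Rabs_def2 in S1. apply Rabs_def2 in S2.
        set (u := f (sc i p)) in *. set (u' := f (sc (S i) p)) in *.
        set (v := g (sc i p)) in *. set (v' := g (sc (S i) p)) in *.
        assert ((u' - u) ^ 2 < 1 / 4) by nra. assert ((v' - v) ^ 2 < 1 / 4) by nra.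
        nra. }
      assert (HQP : Q p ^ 2 + P p ^ 2 = 1).
      { transitivity ((f (sc i p) ^ 2 + g (sc i p) ^ 2)
                      * (f (sc (S i) p) ^ 2 + g (sc (S i) p) ^ 2)).
        - unfold P, Q; ring.
        - rewrite Hu1, Hu2; ring. }
      destruct (atan_quotient _ _ HQ HQP) as [Ec Es].
      assert (Cf1 : continuous (fun q => f (sc i q)) p) by (apply (continuous_comp (sc i) f); auto).
      assert (Cg1 : continuous (fun q => g (sc i q)) p) by (apply (continuous_comp (sc i) g); auto).
      assert (Cf2 : continuous (fun q => f (sc (S i) q)) p) by (apply (continuous_comp (sc (S i)) f); auto).
      assert (Cg2 : continuous (fun q => g (sc (S i) q)) p) by (apply (continuous_comp (sc (S i)) g); auto).
      split; [|rewrite cos_plus, sin_plus, Ec, Es, <- Hfi, <- Hgi; unfold P, Q].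
      + apply continuous_Rplus; [exact HcA|].
        apply (continuous_R_comp (fun q => P q / Q q) atan).
        * apply continuous_Rdiv; [| |lra].
          -- now apply continuous_Rminus; apply continuous_Rmult.
          -- now apply continuous_Rplus; apply continuous_Rmult.
        * apply derivable_continuous_pt, derivable_pt_atan.
      + set (u := f (sc i p)) in *. set (u' := f (sc (S i) p)) in *.
        set (v := g (sc i p)) in *. set (v' := g (sc (S i) p)) in *.
        split; [transitivity ((u ^ 2 + v ^ 2) * u')|transitivity ((u ^ 2 + v ^ 2) * v')];
          try ring; rewrite Hu1; ring. }
  destruct (Hind (S n)) as [A HA]; [lia|].
  exists A. intros p Hp. destruct (HA p Hp) as (H1 & H2 & H3).
  assert (E : sc (S n) p = p).
  { unfold sc. rewrite (surjective_pairing p) at 3. f_equal; field; lra. }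
  rewrite E in H2, H3. auto.
Qed.

Lemma continuous_argument (f g : R * R -> R) (a b c d : R) :
  a <= b -> c <= d ->
  (forall p, in_rect a b c d p ->
     continuous f p /\ continuous g p /\ ~ (f p = 0 /\ g p = 0)) ->
  exists A m : R * R -> R, forall p, in_rect a b c d p ->
    continuous A p /\ 0 < m p /\ f p = m p * cos (A p) /\ g p = m p * sin (A p).
Proof.
  intros Hab Hcd H.
  set (m := fun p => sqrt (f p * f p + g p * g p)).
  assert (Hm : forall p, in_rect a b c d p ->
    continuous m p /\ 0 < m p /\ m p ^ 2 = f p ^ 2 + g p ^ 2).
  { intros p Hp. destruct (H p Hp) as (Hf & Hg & Hn).
    assert (0 < f p * f p + g p * g p).
    { destruct (Req_dec (f p) 0) as [E|E].
      - assert (g p <> 0) by tauto. nra.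
      - nra. }
    repeat split.
    - apply (continuous_R_comp (fun p => f p * f p + g p * g p) sqrt).
      + now apply continuous_Rplus; apply continuous_Rmult.
      + apply continuity_pt_sqrt. lra.
    - now apply sqrt_lt_R0.
    - unfold m. rewrite pow2_sqrt by lra. ring. }
  destruct (continuous_argument_unit (fun p => f p / m p) (fun p => g p / m p) a b c d)
    as [A HA]; auto.
  { intros p Hp. destruct (Hm p Hp) as (Hc & Hpos & E). destruct (H p Hp) as (Hf & Hg & _).
    repeat split; try (apply continuous_Rdiv; auto; lra).
    replace (_ + _) with ((f p ^ 2 + g p ^ 2) / m p ^ 2) by (field; lra).
    rewrite <- E. field. lra. }
  exists A, m. intros p Hp. destruct (HA p Hp) as (HcA & Ec & Es).
  destruct (Hm p Hp) as (_ & Hpos & _).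
  repeat split; auto; [rewrite <- Ec|rewrite <- Es]; field; lra.
Qed.

(** * Closed curves with increasing tangent angle *)

Lemma cos_eq_1_2PI (u : R) : cos u = 1 -> exists k : Z, u = 2 * PI * IZR k.
Proof.
  intros H. destruct (sin_eq_0_0 (u / 2)) as [k Hk].
  - replace u with (2 * (u / 2)) in H by field. rewrite cos_2a_sin in H. nra.
  - exists k. lra.
Qed.

(** Comparing squared norms gives [m = m']. Congruence of angles modulo [2 PI] is recorded as
    [cos (u - v) = 1], which can be checked pointwise along a path and which [cos_eq_1_2PI] converts
    into an integer. *)
Lemma same_direction (m m' u v : R) :
  0 < m -> 0 < m' -> m * cos u = m' * cos v -> m * sin u = m' * sin v ->
  cos (u - v) = 1.
Proof.
  intros Hm Hm' Hc Hs.
  assert (Eu := sin2_cos2 u). assert (Ev := sin2_cos2 v). unfold Rsqr in Eu, Ev.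
  assert (E : m * m = m' * m').
  { transitivity ((m * cos u) * (m * cos u) + (m * sin u) * (m * sin u)).
    - transitivity (m * m * (sin u * sin u + cos u * cos u)); [rewrite Eu|]; ring.
    - rewrite Hc, Hs.
      transitivity (m' * m' * (sin v * sin v + cos v * cos v)); [|rewrite Ev]; ring. }
  assert (m = m') by nra. subst m'.
  apply Rmult_eq_reg_l in Hc; [|lra]. apply Rmult_eq_reg_l in Hs; [|lra].
  rewrite cos_minus, Hc, Hs. lra.
Qed.

(** With a larger increase, [A] would take both values [c] and [c + PI] for every [c] in an interval
    of positive length. Their cosines are opposite and both nonnegative, so the cosine would vanish
    on that interval. *)
Lemma halfplane_increase_le (A : R -> R) (a b alpha : R) :
  a <= b -> (forall t, a <= t <= b -> continuity_pt A t /\ 0 <= cos (A t - alpha)) ->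
  A b - A a <= PI.
Proof.
  intros Hab H. destruct (Rle_lt_dec (A b - A a) PI) as [Hle|Hgt]; [exact Hle|exfalso].
  assert (HPI := PI_RGT_0). assert (HPI2 := PI2_1).
  assert (Hlt : a < b) by (destruct (Req_dec a b); [subst|]; lra).
  assert (Hv : forall c, A a <= c <= A b -> 0 <= cos (c - alpha)).
  { intros c Hc. destruct (f_interv_is_interv A a b c) as [t [Ht Et]]; auto.
    - intros t Ht. now apply H.
    - rewrite <- Et. now apply H. }
  (* The cap 1 keeps [eta] below [PI], hence [sin eta] positive. *)
  set (eta := Rmin 1 (A b - A a - PI)).
  assert (He1 : eta <= 1) by apply Rmin_l.
  assert (He2 : eta <= A b - A a - PI) by apply Rmin_r.
  assert (He0 : 0 < eta) by (apply Rmin_pos; lra).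
  assert (Hz : forall c, A a <= c -> c + PI <= A b -> cos (c - alpha) = 0).
  { intros c H1 H2. assert (P1 := Hv c). assert (P2 := Hv (c + PI)).
    replace (c + PI - alpha) with (c - alpha + PI) in P2 by ring.
    rewrite neg_cos in P2. lra. }
  assert (Z1 := Hz (A a)). assert (Z2 := Hz (A a + eta)).
  replace (A a + eta - alpha) with (A a - alpha + eta) in Z2 by ring.
  rewrite cos_plus, Z1 in Z2 by lra.
  assert (Hs := sin_gt_0 eta). assert (E := sin2_cos2 (A a - alpha)).
  unfold Rsqr in E. rewrite Z1 in E by lra.
  assert (sin (A a - alpha) * sin eta = 0) by lra.
  assert (0 < sin eta) by (apply Hs; lra). nra.
Qed.

(** In an open half-plane the values [A a] and [A a + PI] already exclude each other. The strict
    bounds bring the sum of the four variations in [turning_at_lowest_point] below [4 PI]. *)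
Lemma halfplane_increase_lt (A : R -> R) (a b alpha : R) :
  a <= b -> (forall t, a <= t <= b -> continuity_pt A t /\ 0 < cos (A t - alpha)) ->
  A b - A a < PI.
Proof.
  intros Hab H. destruct (Rlt_le_dec (A b - A a) PI) as [Hlt|Hge]; [exact Hlt|exfalso].
  assert (HPI := PI_RGT_0).
  assert (Hlt : a < b) by (destruct (Req_dec a b); [subst|]; lra).
  destruct (f_interv_is_interv A a b (A a + PI)) as [t [Ht Et]]; [lra|lra|now apply H|].
  destruct (H t Ht) as [_ P1]. destruct (H a) as [_ P2]; [lra|].
  rewrite Et in P1. replace (A a + PI - alpha) with (A a - alpha + PI) in P1 by ring.
  rewrite neg_cos in P1. lra.
Qed.

Lemma halfplane_variation_le (A : R -> R) (a b alpha : R) :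
  a <= b -> (forall t, a <= t <= b -> continuity_pt A t /\ 0 <= cos (A t - alpha)) ->
  - PI <= A b - A a <= PI.
Proof.
  intros Hab H. split; [|now apply (halfplane_increase_le A a b alpha)].
  enough (- A b - - A a <= PI) by lra.
  apply (halfplane_increase_le (fun t => - A t) a b (- alpha)); [exact Hab|].
  intros t Ht. destruct (H t Ht) as [Hc Hp]. split.
  - now apply continuity_pt_opp.
  - rewrite <- cos_neg. now replace (- (- A t - - alpha)) with (A t - alpha) by ring.
Qed.

Lemma halfplane_variation_lt (A : R -> R) (a b alpha : R) :
  a <= b -> (forall t, a <= t <= b -> continuity_pt A t /\ 0 < cos (A t - alpha)) ->
  - PI < A b - A a < PI.
Proof.
  intros Hab H. split; [|now apply (halfplane_increase_lt A a b alpha)].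
  enough (- A b - - A a < PI) by lra.
  apply (halfplane_increase_lt (fun t => - A t) a b (- alpha)); [exact Hab|].
  intros t Ht. destruct (H t Ht) as [Hc Hp]. split.
  - now apply continuity_pt_opp.
  - rewrite <- cos_neg. now replace (- (- A t - - alpha)) with (A t - alpha) by ring.
Qed.

(** The values are multiples of [2 PI], while [cos = 1] keeps [D] in an open half-plane, so its
    variation is less than [PI]. *)
Lemma constant_of_cos_eq_1 (D : R -> R) (a b : R) :
  a <= b -> (forall u, a <= u <= b -> continuity_pt D u /\ cos (D u) = 1) -> D a = D b.
Proof.
  intros Hab H.
  assert (V : - PI < D b - D a < PI).
  { apply (halfplane_variation_lt D a b 0 Hab).
    intros u Hu. destruct (H u Hu) as [Hc H1]. split; [exact Hc|].
    rewrite Rminus_0_r, H1. lra. }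
  destruct (cos_eq_1_2PI (D a)) as [j Hj]; [apply H; lra|].
  destruct (cos_eq_1_2PI (D b)) as [k Hk]; [apply H; lra|].
  assert (HPI := PI_RGT_0).
  assert (-1 < IZR (k - j) < 1).
  { rewrite minus_IZR. rewrite Hj, Hk in V. split; nra. }
  assert (k - j = 0)%Z.
  { assert (-1 < k - j < 1)%Z by (split; apply lt_IZR; lra). lia. }
  replace k with j in Hk by lia. congruence.
Qed.

Lemma derive_pos_increasing (g dg : R -> R) (a b : R) :
  a < b -> (forall t, is_derive g t (dg t)) -> (forall t, a < t < b -> 0 < dg t) ->
  g a < g b.
Proof.
  intros Hab Hd Hp.
  destruct (MVT_cor2 g dg a b Hab) as [c [Ec Hc]].
  - intros c _. now apply is_derive_Reals.
  - specialize (Hp c Hc). nra.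
Qed.

(** [theta] is a lift of the tangent angle to the real line and [rho] is the speed. How much [theta]
    gains over one period is not a field: it is the conclusion of [turning]. *)
Record convex_loop (x y theta rho : R -> R) : Prop := {
  loop_dx : forall t, is_derive x t (rho t * cos (theta t));
  loop_dy : forall t, is_derive y t (rho t * sin (theta t));
  loop_speed : forall t, 0 < rho t;
  loop_theta_cont : continuity theta;
  loop_theta_incr : forall s t, s < t -> theta s < theta t;
  loop_periodic_x : forall t, x (t + 2 * PI) = x t;
  loop_periodic_y : forall t, y (t + 2 * PI) = y t;
  loop_simple : forall s t, s < t < s + 2 * PI -> ~ (x t = x s /\ y t = y s)
}.

Lemma is_derive_continuity_pt (f : R -> R) (t l : R) :
  is_derive f t l -> continuity_pt f t.
Proof.
  intros H. apply derivable_continuous_pt. exists l. now apply is_derive_Reals.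
Qed.

Lemma is_derive_shift (f : R -> R) (t l a : R) :
  is_derive f (t + a) l -> is_derive (fun s => f (s + a)) t l.
Proof.
  intros H. replace l with (scal 1 l) by apply Rmult_1_l.
  apply (is_derive_comp f (fun s => s + a)); [exact H|].
  auto_derive; [exact I|ring].
Qed.

Lemma continuity_pt_path (A : R * R -> R) (sigma tau : R -> R) (u : R) :
  continuous A (sigma u, tau u) -> continuity_pt sigma u -> continuity_pt tau u ->
  continuity_pt (fun v => A (sigma v, tau v)) u.
Proof.
  intros HA Hs Ht. apply continuity_pt_filterlim.
  apply (continuous_comp (fun v => (sigma v, tau v)) A); [|exact HA].
  now apply continuous_Rpair; apply continuity_pt_filterlim.
Qed.

Lemma periodic_nat (P : R -> Prop) (T : R) :
  (forall t, P (t + T) <-> P t) -> forall (n : nat) t, P (t + INR n * T) <-> P t.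
Proof.
  intros HP n. induction n as [|n IH]; intros t.
  - change (INR 0) with 0. now replace (t + 0 * T) with t by ring.
  - rewrite S_INR. replace (t + (INR n + 1) * T) with (t + INR n * T + T) by ring.
    now rewrite HP.
Qed.

Lemma periodic_forall (P : R -> Prop) (a T : R) :
  0 < T -> (forall t, P (t + T) <-> P t) -> (forall t, a <= t <= a + T -> P t) ->
  forall t, P t.
Proof.
  intros HT HP H t.
  assert (W : forall s, 0 <= s -> exists n, INR n * T <= s < INR n * T + T).
  { intros s Hs. destruct (nfloor_ex (s / T)) as [n Hn].
    - apply Rdiv_le_0_compat; lra.
    - exists n. assert (E : s = s / T * T) by (field; lra).
      set (q := s / T) in *. rewrite E. split; nra. }
  destruct (Rle_dec a t) as [Hat|Hat].
  - destruct (W (t - a)) as [n Hn]; [lra|].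
    replace t with (t - INR n * T + INR n * T) by ring.
    apply (periodic_nat P T HP). apply H. lra.
  - destruct (W (a - t)) as [n Hn]; [lra|].
    apply (periodic_nat P T HP (S n)). apply H. rewrite S_INR. lra.
Qed.

Lemma Cmod_polar (q t : R) : 0 <= q -> Cmod (RtoC q * cis t)%C = q.
Proof.
  intros Hq. rewrite Cmod_mult, Cmod_R, Rabs_pos_eq by exact Hq.
  replace (Cmod (cis t)) with 1; [ring|]. unfold Cmod, cis; cbn [fst snd].
  symmetry. replace (_ + _) with 1; [apply sqrt_1|].
  assert (V := sin2_cos2 t). unfold Rsqr in V. lra.
Qed.

Lemma continuous_polar (p : R * R) :
  @continuous (prod_UniformSpace R_UniformSpace R_UniformSpace) C_UniformSpace
    (fun p : R * R => (RtoC (fst p) * cis (snd p))%C) p.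
Proof.
  destruct p as [q t].
  assert (Cq := @continuous_fst R_UniformSpace R_UniformSpace q t).
  assert (Ct := @continuous_snd R_UniformSpace R_UniformSpace q t).
  assert (Cc := continuous_R_comp _ cos _ Ct (continuity_cos _)).
  assert (Cs := continuous_R_comp _ sin _ Ct (continuity_sin _)).
  unfold cis, Cmult, RtoC; cbn [fst snd].
  apply continuous_Rpair; [apply continuous_Rminus|apply continuous_Rplus];
    apply continuous_Rmult; auto; apply continuous_const.
Qed.

Section ConvexLoop.
Context {x y theta rho : R -> R} (L : convex_loop x y theta rho).

Lemma loop_cont_x : continuity x.
Proof. intros t. exact (is_derive_continuity_pt _ _ _ (loop_dx _ _ _ _ L t)). Qed.

Lemma loop_cont_y : continuity y.
Proof. intros t. exact (is_derive_continuity_pt _ _ _ (loop_dy _ _ _ _ L t)). Qed.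

(** The projection of the curve on the direction [alpha] has derivative
    [rho u * cos (theta u - alpha)], so it increases. *)
Lemma chord_positive (s t alpha : R) :
  s < t -> (forall u, s < u < t -> 0 < cos (theta u - alpha)) ->
  0 < (x t - x s) * cos alpha + (y t - y s) * sin alpha.
Proof.
  intros Hst H.
  enough (x s * cos alpha + y s * sin alpha < x t * cos alpha + y t * sin alpha) by lra.
  apply (derive_pos_increasing (fun u => x u * cos alpha + y u * sin alpha)
          (fun u => rho u * cos (theta u - alpha))); [exact Hst| |].
  - intros u. rewrite cos_minus.
    replace (rho u * _) with
      (rho u * cos (theta u) * cos alpha + rho u * sin (theta u) * sin alpha) by ring.
    apply (is_derive_plus (K := R_AbsRing) (V := R_NormedModule)).
    + apply (is_derive_scal_l (K := R_AbsRing) (V := R_NormedModule) x), L.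
    + apply (is_derive_scal_l (K := R_AbsRing) (V := R_NormedModule) y), L.
  - intros u Hu. apply Rmult_lt_0_compat; [apply L|now apply H].
Qed.

Lemma cos_turn (t : R) : cos (theta (t + 2 * PI) - theta t) = 1.
Proof.
  apply (same_direction (rho (t + 2 * PI)) (rho t)); try apply L.
  - rewrite <- (is_derive_unique _ _ _ (loop_dx _ _ _ _ L t)).
    symmetry. apply is_derive_unique.
    apply (is_derive_ext (fun s => x (s + 2 * PI))); [apply L|].
    apply is_derive_shift, L.
  - rewrite <- (is_derive_unique _ _ _ (loop_dy _ _ _ _ L t)).
    symmetry. apply is_derive_unique.
    apply (is_derive_ext (fun s => y (s + 2 * PI))); [apply L|].
    apply is_derive_shift, L.
Qed.

(* Hopf's Umlaufsatz at a lowest point [a]: on the rectangle of pairs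
   [(s, delta)], the secant direction [Gamma (s + delta) - Gamma s] has a continuous
   argument.  Along [delta = eps] it follows the tangent; going round the other
   three sides it varies by less than [4 PI], since the two long pieces stay in a
   half-plane by the choice of [a]. *)
Lemma turning_at_lowest_point (a : R) :
  (forall t, y a <= y t) -> theta (a + 2 * PI) = theta a + 2 * PI.
Proof.
  intros Ha.
  assert (HPI := PI_RGT_0). assert (HPI2 := PI2_1).
  set (b := a + 2 * PI).
  assert (hp2 : 0 < PI / 2) by lra.
  (* The window exceeds the period by 1 on each side because the short chords used below leave it by
     up to [eps], which is at most 1. On such a chord the tangent turns by less than a right
     angle. *)
  destruct (Heine_cor2 (f := theta) (a := a - 1) (b := b + 1)) with (eps := mkposreal _ hp2) as [dl Hdl].
  { intros u _. apply L. }
  simpl in Hdl.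
  set (eps := Rmin 1 (dl / 2)).
  assert (He1 : eps <= 1) by apply Rmin_l.
  assert (He2 : eps <= dl / 2) by apply Rmin_r.
  assert (Hdl0 := cond_pos dl).
  assert (He0 : 0 < eps) by (apply Rmin_pos; lra).
  assert (Hth : forall u v, a - 1 <= u <= b + 1 -> a - 1 <= v <= b + 1 ->
     - eps <= u - v <= eps -> 0 < cos (theta u - theta v)).
  { intros u v Hu Hv Huv.
    assert (Hd : Rabs (theta u - theta v) < PI / 2).
    { apply Hdl; auto. apply Rabs_def1; lra. }
    apply Rabs_def2 in Hd. apply cos_gt_0; lra. }
  destruct (continuous_argument (fun p => x (fst p + snd p) - x (fst p))
             (fun p => y (fst p + snd p) - y (fst p)) a b eps (2 * PI - eps))
    as (A & m & HA).
  { unfold b; lra. } { lra. }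
  { intros [s d] [Hs Hd]. cbn [fst snd] in *.
    assert (Cs : continuous (fun p : R * R => fst p) (s, d)) by apply continuous_fst.
    assert (Cd : continuous (fun p : R * R => snd p) (s, d)) by apply continuous_snd.
    assert (Csd : continuous (fun p : R * R => fst p + snd p) (s, d))
      by now apply continuous_Rplus.
    split; [|split].
    - apply continuous_Rminus; apply (continuous_R_comp _ x); auto; apply loop_cont_x.
    - apply continuous_Rminus; apply (continuous_R_comp _ y); auto; apply loop_cont_y.
    - intros [E1 E2]. apply (loop_simple _ _ _ _ L s (s + d)); [lra|]. lra. }
  assert (Hm : forall s d alpha, a <= s <= b -> eps <= d <= 2 * PI - eps ->
     0 < m (s, d) /\ continuous A (s, d) /\
     m (s, d) * cos (A (s, d) - alpha) =
       (x (s + d) - x s) * cos alpha + (y (s + d) - y s) * sin alpha).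
  { intros s d alpha Hs Hd. destruct (HA (s, d)) as (Hc & Hmp & E1 & E2).
    { split; assumption. }
    cbn [fst snd] in *. repeat split; auto. rewrite cos_minus, E1, E2. ring. }
  assert (Hbd : b - a = 2 * PI) by (unfold b; ring).
  assert (Cid : forall u, continuity_pt (fun v => v) u)
    by (intros u; apply derivable_continuous_pt, derivable_pt_id).
  assert (Ccst : forall c u, continuity_pt (fun _ => c) u)
    by (intros c u; apply continuity_pt_const; intros ? ?; reflexivity).
  assert (Vt : - PI < (A (b, eps) - theta b) - (A (a, eps) - theta a) < PI).
  { apply (halfplane_variation_lt (fun u => A (u, eps) - theta u) a b 0); [lra|].
    intros u Hu. destruct (Hm u eps (theta u)) as (Mp & Mc & ME); [lra|lra|].
    split.
    - apply continuity_pt_minus; [|apply L]. now apply (continuity_pt_path A (fun v => v) (fun _ => eps)).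
    - rewrite Rminus_0_r.
      assert (P : 0 < (x (u + eps) - x u) * cos (theta u) + (y (u + eps) - y u) * sin (theta u)).
      { apply chord_positive; [lra|]. intros v Hv. apply Hth; lra. }
      rewrite <- ME in P. nra. }
  assert (V1 : - PI <= A (a, 2 * PI - eps) - A (a, eps) <= PI).
  { apply (halfplane_variation_le (fun u => A (a, u)) eps (2 * PI - eps) (PI / 2)); [lra|].
    intros u Hu. destruct (Hm a u (PI / 2)) as (Mp & Mc & ME); [lra|lra|].
    split; [now apply (continuity_pt_path A (fun _ => a) (fun v => v))|].
    rewrite cos_PI2, sin_PI2 in ME. assert (Hy := Ha (a + u)). nra. }
  (* By periodicity the secant of length parameter [2 * PI - eps] is the reversed short chord from
     [u - eps] to [u]; it makes an acute angle with [theta a + PI]. *)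
  assert (V2 : - PI < A (a + eps, 2 * PI - eps) - A (a, 2 * PI - eps) < PI).
  { apply (halfplane_variation_lt (fun u => A (u, 2 * PI - eps)) a (a + eps) (theta a + PI)); [lra|].
    intros u Hu. destruct (Hm u (2 * PI - eps) (theta a + PI)) as (Mp & Mc & ME); [lra|lra|].
    split; [now apply (continuity_pt_path A (fun v => v) (fun _ => 2 * PI - eps))|].
    rewrite neg_cos, neg_sin in ME.
    replace (u + (2 * PI - eps)) with (u - eps + 2 * PI) in ME by ring.
    rewrite (loop_periodic_x _ _ _ _ L), (loop_periodic_y _ _ _ _ L) in ME.
    assert (P : 0 < (x u - x (u - eps)) * cos (theta a) + (y u - y (u - eps)) * sin (theta a)).
    { apply chord_positive; [lra|]. intros v Hv. apply Hth; lra. }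
    nra. }
  (* Here the path follows the antidiagonal [s + delta = a + 2 * PI]: every secant ends at the
     lowest point, so it stays in the closed lower half-plane. *)
  assert (V3 : - PI <= A (b - eps, a + 2 * PI - (b - eps))
                       - A (a + eps, a + 2 * PI - (a + eps)) <= PI).
  { apply (halfplane_variation_le (fun u => A (u, a + 2 * PI - u)) (a + eps) (b - eps) (- (PI / 2)));
      [lra|].
    intros u Hu. destruct (Hm u (a + 2 * PI - u) (- (PI / 2))) as (Mp & Mc & ME); [lra|lra|].
    split.
    { apply (continuity_pt_path A (fun v => v) (fun v => a + 2 * PI - v)); auto.
      apply continuity_pt_minus; auto. }
    rewrite cos_neg, sin_neg, cos_PI2, sin_PI2 in ME.
    replace (u + (a + 2 * PI - u)) with (a + 2 * PI) in ME by ring.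
    rewrite (loop_periodic_y _ _ _ _ L) in ME.
    assert (Hy := Ha u). nra. }
  replace (a + 2 * PI - (b - eps)) with eps in V3 by (unfold b; ring).
  replace (a + 2 * PI - (a + eps)) with (2 * PI - eps) in V3 by ring.
  assert (V4 : - PI < A (b, eps) - A (b - eps, eps) < PI).
  { apply (halfplane_variation_lt (fun u => A (u, eps)) (b - eps) b (theta b)); [lra|].
    intros u Hu. destruct (Hm u eps (theta b)) as (Mp & Mc & ME); [lra|lra|].
    split; [now apply (continuity_pt_path A (fun v => v) (fun _ => eps))|].
    assert (P : 0 < (x (u + eps) - x u) * cos (theta b) + (y (u + eps) - y u) * sin (theta b)).
    { apply chord_positive; [lra|]. intros v Hv. apply Hth; lra. }
    nra. }
  assert (E1 : cos (A (b, eps) - A (a, eps)) = 1).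
  { destruct (HA (a, eps)) as (_ & Ma & Xa & Ya); [split; simpl; lra|].
    destruct (HA (b, eps)) as (_ & Mb & Xb & Yb); [split; simpl; lra|].
    cbn [fst snd] in *.
    replace (b + eps) with (a + eps + 2 * PI) in Xb, Yb by (unfold b; ring).
    unfold b in Xb at 1, Yb at 1.
    rewrite !(loop_periodic_x _ _ _ _ L) in Xb. rewrite !(loop_periodic_y _ _ _ _ L) in Yb.
    apply (same_direction (m (b, eps)) (m (a, eps))); congruence. }
  destruct (cos_eq_1_2PI _ E1) as [j Hj].
  assert (E2 := cos_turn a). fold b in E2.
  destruct (cos_eq_1_2PI _ E2) as [k Hk].
  assert (Hpos : theta a < theta b) by (apply L; lra).
  (* The four pieces sum to less than [4 PI], so [j <= 1]; by [Vt] the integers [j] and [k] differ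
     by less than 1/2, and [k] is positive since [theta] increases. Hence [k = 1]. *)
  assert (Hj1 : (j < 2)%Z) by (apply lt_IZR; nra).
  assert (Hj2 : IZR j <= 1) by (apply IZR_le; lia).
  assert (Hk1 : (k < 2)%Z) by (apply lt_IZR; nra).
  assert (Hk2 : (0 < k)%Z) by (apply lt_IZR; nra).
  replace k with 1%Z in Hk by lia. lra.
Qed.

(** The gain of [theta] over a period is continuous in the starting point and a multiple of [2 PI],
    so its value at a lowest point is its value everywhere. *)
Lemma turning (t : R) : theta (t + 2 * PI) = theta t + 2 * PI.
Proof.
  assert (HPI := PI_RGT_0).
  destruct (continuity_ab_min y 0 (0 + 2 * PI)) as [a [Ha _]]; [lra|intros; apply loop_cont_y|].
  assert (Hmin : forall s, y a <= y s).
  { apply (periodic_forall _ 0 (2 * PI)); [lra| |exact Ha].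
    intros s. now rewrite (loop_periodic_y _ _ _ _ L). }
  assert (E := turning_at_lowest_point a Hmin).
  assert (C : forall u v, u <= v ->
    theta (u + 2 * PI) - theta u = theta (v + 2 * PI) - theta v).
  { intros u v Huv.
    apply (constant_of_cos_eq_1 (fun u => theta (u + 2 * PI) - theta u)); [exact Huv|].
    intros s _. split; [|apply cos_turn].
    apply continuity_pt_minus; [|apply L].
    apply (continuity_pt_comp (fun v => v + 2 * PI) theta); [reg|apply L]. }
  destruct (Rle_dec t a) as [H|H]; [pose proof (C t a)|pose proof (C a t)]; lra.
Qed.

(* Signed distance of [w] from the tangent at [t], positive on its left. *)
Definition height (t : R) (w : R * R) : R :=
  cos (theta t) * (snd w - y t) - sin (theta t) * (fst w - x t).

(** Let [t1] be the parameter where the tangent is reversed. Up to [t1] the curve moves away from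
    the tangent at [t], in the direction of its left normal; after [t1] it moves back and reaches
    distance zero only at [t + 2 * PI]. The two cases measure the chord from [t] and the chord to
    [t + 2 * PI]. *)
Lemma height_curve_pos (t s : R) : t < s < t + 2 * PI -> 0 < height t (x s, y s).
Proof.
  intros Hs. unfold height; cbn [fst snd].
  assert (HPI := PI_RGT_0). assert (HT := turning t).
  destruct (f_interv_is_interv theta t (t + 2 * PI) (theta t + PI)) as [t1 [H1 E1]];
    [lra|lra|intros; apply L|].
  assert (Hmono := loop_theta_incr _ _ _ _ L).
  destruct (Rle_lt_dec s t1) as [Hle|Hgt].
  - assert (P : 0 < (x s - x t) * cos (theta t + PI / 2) + (y s - y t) * sin (theta t + PI / 2)).
    { apply chord_positive; [lra|]. intros u Hu.
      replace (theta u - (theta t + PI / 2)) with ((theta u - theta t) - PI / 2) by ring.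
      assert (theta t < theta u) by (apply Hmono; lra).
      assert (theta u < theta t1) by (apply Hmono; lra).
      apply cos_gt_0; lra. }
    rewrite cos_plus, sin_plus, cos_PI2, sin_PI2 in P. lra.
  - assert (P : 0 < (x (t + 2 * PI) - x s) * cos (theta t + 3 * (PI / 2))
                    + (y (t + 2 * PI) - y s) * sin (theta t + 3 * (PI / 2))).
    { apply chord_positive; [lra|]. intros u Hu.
      assert (theta t1 < theta u) by (apply Hmono; lra).
      assert (theta u < theta (t + 2 * PI)) by (apply Hmono; lra).
      apply cos_gt_0; lra. }
    rewrite (loop_periodic_x _ _ _ _ L), (loop_periodic_y _ _ _ _ L) in P.
    rewrite cos_plus, sin_plus, cos_3PI2, sin_3PI2 in P. lra.
Qed.

Lemma height_periodic (t : R) (w : R * R) : height (t + 2 * PI) w = height t w.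
Proof.
  unfold height. rewrite turning, cos_plus, sin_plus, cos_2PI, sin_2PI.
  rewrite (loop_periodic_x _ _ _ _ L), (loop_periodic_y _ _ _ _ L). ring.
Qed.

Lemma height_continuity (w : R * R) : continuity (fun t => height t w).
Proof.
  intros t. unfold height.
  assert (Hc := continuity_pt_comp theta cos t (loop_theta_cont _ _ _ _ L t) (continuity_cos _)).
  assert (Hs := continuity_pt_comp theta sin t (loop_theta_cont _ _ _ _ L t) (continuity_sin _)).
  assert (Hk : forall c, continuity_pt (fun _ => c) t)
    by (intros c; apply continuity_pt_const; intros ? ?; reflexivity).
  apply continuity_pt_minus; apply continuity_pt_mult; auto;
    apply continuity_pt_minus; auto; [apply loop_cont_y|apply loop_cont_x].
Qed.

Lemma height_min_exists (w : R * R) : exists t, forall s, height t w <= height s w.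
Proof.
  assert (HPI := PI_RGT_0).
  destruct (continuity_ab_min (fun t => height t w) 0 (0 + 2 * PI)) as [t [Ht _]];
    [lra|intros; apply height_continuity|].
  exists t. apply (periodic_forall _ 0 (2 * PI)); [lra| |exact Ht].
  intros s. now rewrite height_periodic.
Qed.

(** The constant does not depend on [t]. This makes the smallest height over all tangents continuous
    in the point, and the interior open. *)
Lemma height_lipschitz (t : R) (w w' : R * R) :
  Rabs (height t w' - height t w) <= Rabs (fst w' - fst w) + Rabs (snd w' - snd w).
Proof.
  unfold height.
  replace (_ - _) with
    (cos (theta t) * (snd w' - snd w) + - (sin (theta t) * (fst w' - fst w))) by ring.
  eapply Rle_trans; [apply Rabs_triang|]. rewrite Rabs_Ropp, !Rabs_mult.
  assert (Rabs (cos (theta t)) <= 1) by (apply Rabs_le, COS_bound).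
  assert (Rabs (sin (theta t)) <= 1) by (apply Rabs_le, SIN_bound).
  assert (P1 := Rabs_pos (fst w' - fst w)). assert (P2 := Rabs_pos (snd w' - snd w)).
  nra.
Qed.

Lemma height_self (t : R) : height t (x t, y t) = 0.
Proof. unfold height; cbn [fst snd]. ring. Qed.

Lemma height_curve_nonneg (t s : R) : 0 <= height t (x s, y s).
Proof.
  assert (HPI := PI_RGT_0). revert s.
  apply (periodic_forall _ t (2 * PI)); [lra| |].
  - intros s. now rewrite (loop_periodic_x _ _ _ _ L), (loop_periodic_y _ _ _ _ L).
  - intros s [[H1|H1] [H2|H2]].
    + left. apply height_curve_pos. lra.
    + subst s. rewrite (loop_periodic_x _ _ _ _ L), (loop_periodic_y _ _ _ _ L), height_self.
      lra.
    + subst s. rewrite height_self. lra.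
    + lra.
Qed.

(** * The region to the left of all tangents *)

Definition loop_interior (w : R * R) : Prop := forall t, 0 < height t w.

(** The midpoint of a chord works: a tangent has height zero at its own point of contact only, so at
    least one of the two ends lies strictly to its left and the other is not to its right. *)
Lemma loop_interior_nonempty : exists w, loop_interior w.
Proof.
  assert (HPI := PI_RGT_0).
  exists ((x 0 + x PI) / 2, (y 0 + y PI) / 2).
  assert (E : forall t, height t ((x 0 + x PI) / 2, (y 0 + y PI) / 2) =
     (height t (x 0, y 0) + height t (x PI, y PI)) / 2).
  { intros t. unfold height; cbn [fst snd]. field. }
  unfold loop_interior. apply (periodic_forall _ 0 (2 * PI)); [lra| |].
  { intros t. now rewrite height_periodic. }
  assert (H0 : 0 < height 0 ((x 0 + x PI) / 2, (y 0 + y PI) / 2)).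
  { rewrite E, height_self. assert (P := height_curve_pos 0 PI). lra. }
  intros t [[H1|H1] [H2|H2]].
  - rewrite E. assert (P := height_curve_nonneg t PI).
    assert (Q := height_curve_pos t (0 + 2 * PI)).
    rewrite (loop_periodic_x _ _ _ _ L), (loop_periodic_y _ _ _ _ L) in Q. lra.
  - subst t. now rewrite height_periodic.
  - now subst t.
  - now subst t.
Qed.

Lemma loop_interior_convex (w1 w2 : R * R) (s : R) :
  loop_interior w1 -> loop_interior w2 -> 0 <= s <= 1 ->
  loop_interior ((1 - s) * fst w1 + s * fst w2, (1 - s) * snd w1 + s * snd w2).
Proof.
  intros H1 H2 Hs t. specialize (H1 t). specialize (H2 t).
  replace (height t _) with ((1 - s) * height t w1 + s * height t w2)
    by (unfold height; cbn [fst snd]; ring).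
  nra.
Qed.

Lemma loop_interior_open : @open C_UniformSpace loop_interior.
Proof.
  intros w Hw. destruct (height_min_exists w) as [t0 Ht0].
  assert (He : 0 < height t0 w / 2) by (specialize (Hw t0); lra).
  exists (mkposreal _ He). intros w' [B1 B2] t.
  change (Rabs (fst w' - fst w) < height t0 w / 2) in B1.
  change (Rabs (snd w' - snd w) < height t0 w / 2) in B2.
  assert (K := height_lipschitz t w w'). assert (K0 := Ht0 t).
  assert (K1 : Rabs (height t w' - height t w) < height t0 w) by lra.
  apply Rabs_def2 in K1. lra.
Qed.

(* A tangent line meets the closed region only at the point of tangency: any
   other point [Gamma t + p * cis (theta t)] lies strictly beyond the tangent at a
   nearby parameter, taken on the side of the sign of [p]. *)
Lemma height_zero_on_curve (t : R) (w : R * R) :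
  (forall s, 0 <= height s w) -> height t w = 0 -> w = (x t, y t).
Proof.
  intros Hw H0. assert (HPI := PI_RGT_0).
  set (c := cos (theta t)). set (d := sin (theta t)).
  assert (U : d * d + c * c = 1) by apply (sin2_cos2 (theta t)).
  set (p := (fst w - x t) * c + (snd w - y t) * d).
  unfold height in H0. fold c d in H0.
  assert (E1 : fst w = x t + p * c).
  { enough (fst w - x t = p * c) by lra. unfold p.
    transitivity ((fst w - x t) * (d * d + c * c)); [rewrite U; ring|].
    transitivity (p * c - d * (c * (snd w - y t) - d * (fst w - x t))); [unfold p; ring|].
    rewrite H0. unfold p. ring. }
  assert (E2 : snd w = y t + p * d).
  { enough (snd w - y t = p * d) by lra. unfold p.
    transitivity ((snd w - y t) * (d * d + c * c)); [rewrite U; ring|].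
    transitivity (p * d + c * (c * (snd w - y t) - d * (fst w - x t))); [unfold p; ring|].
    rewrite H0. unfold p. ring. }
  destruct (Req_dec p 0) as [Hp|Hp].
  { rewrite (surjective_pairing w), E1, E2, Hp. f_equal; ring. }
  exfalso.
  (* [p] and [P s] are the coordinates of [w] and of the curve along the tangent at [t]. As
     [P t = 0], near [t] the value [P s] is smaller than [p] in absolute value. *)
  set (P := fun s => (x s - x t) * c + (y s - y t) * d).
  assert (Hk : forall k, continuity_pt (fun _ => k) t)
    by (intros k; apply continuity_pt_const; intros ? ?; reflexivity).
  assert (CP : continuity_pt P t).
  { apply continuity_pt_plus; apply continuity_pt_mult; auto;
      apply continuity_pt_minus; auto; [apply loop_cont_x|apply loop_cont_y]. }
  assert (Hp' : 0 < Rabs p) by now apply Rabs_pos_lt.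
  apply continuity_pt_locally with (eps := mkposreal _ Hp') in CP.
  assert (hp2 : 0 < PI / 2) by lra.
  assert (CT := loop_theta_cont _ _ _ _ L t).
  apply continuity_pt_locally with (eps := mkposreal _ hp2) in CT.
  destruct (filter_and _ _ CP CT) as [dl Hdl]. simpl in Hdl.
  assert (Hdl0 := cond_pos dl).
  (* This is the height at [s] in the frame of the tangent at [t]. When [s - t] is small and has the
     sign of [p], the first term is negative and the second subtracts a nonnegative quantity. *)
  assert (Key : forall s, height s w =
    (P s - p) * sin (theta s - theta t) - height t (x s, y s) * cos (theta s - theta t)).
  { intros s. unfold height; cbn [fst snd]. fold c d. rewrite E1, E2, sin_minus, cos_minus.
    fold c d. unfold P.
    transitivity ((cos (theta s) * (y t - y s) - sin (theta s) * (x t - x s)) * (d * d + c * c)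
       + p * (cos (theta s) * d - sin (theta s) * c)); [rewrite U|]; ring. }
  assert (Hs : exists s, Rabs (s - t) < dl /\ 0 < p * (s - t)).
  { destruct (Rlt_dec 0 p) as [Hpos|Hneg].
    - exists (t + dl / 2). replace (t + dl / 2 - t) with (dl / 2) by ring.
      split; [rewrite Rabs_pos_eq; lra|]. apply Rmult_lt_0_compat; lra.
    - exists (t - dl / 2). replace (t - dl / 2 - t) with (- (dl / 2)) by ring.
      split; [rewrite Rabs_Ropp, Rabs_pos_eq; lra|]. nra. }
  destruct Hs as [s [Hs1 Hs2]].
  destruct (Hdl s Hs1) as [D1 D2].
  replace (P t) with 0 in D1 by (unfold P; ring). rewrite Rminus_0_r in D1.
  apply Rabs_def2 in D2.
  assert (Hc : 0 < cos (theta s - theta t)) by (apply cos_gt_0; lra).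
  assert (Hh := height_curve_nonneg t s). assert (Hw' := Hw s). rewrite Key in Hw'.
  assert (0 <= (P s - p) * sin (theta s - theta t)) by nra.
  destruct (Rlt_dec 0 p) as [Hpos|Hneg].
  - assert (t < s) by nra.
    assert (theta t < theta s) by now apply L.
    assert (0 < sin (theta s - theta t)) by (apply sin_gt_0; lra).
    rewrite (Rabs_pos_eq p) in D1 by lra. apply Rabs_def2 in D1. nra.
  - assert (s < t) by nra.
    assert (theta s < theta t) by now apply L.
    assert (Hsin : 0 < sin (theta t - theta s)) by (apply sin_gt_0; lra).
    replace (theta t - theta s) with (- (theta s - theta t)) in Hsin by ring.
    rewrite sin_neg in Hsin.
    rewrite (Rabs_left p) in D1 by lra. apply Rabs_def2 in D1. nra.
Qed.

(* If a homotopy of closed curves from a point to the loop avoids [w], then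
   [Gamma - w] has a continuous argument with equal values at both ends of the
   period.  At its maximum this contradicts that the argument is increasing,
   which holds because [w] lies to the left of every tangent. *)
Lemma homotopy_covers_interior (f g : R * R -> R) (r : R) (w : R * R) :
  0 <= r -> loop_interior w ->
  (forall p, in_rect 0 r 0 (2 * PI) p -> continuous f p /\ continuous g p) ->
  (forall t, 0 <= t <= 2 * PI -> f (r, t) = x t /\ g (r, t) = y t) ->
  (forall rho, 0 <= rho <= r -> f (rho, 2 * PI) = f (rho, 0) /\ g (rho, 2 * PI) = g (rho, 0)) ->
  (forall t, 0 <= t <= 2 * PI -> f (0, t) = f (0, 0) /\ g (0, t) = g (0, 0)) ->
  exists p, in_rect 0 r 0 (2 * PI) p /\ f p = fst w /\ g p = snd w.
Proof.
  intros Hr Hw Hc Hbd Hper Hcst. apply NNPP. intros Hno.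
  assert (HPI := PI_RGT_0).
  destruct (continuous_argument (fun p => f p - fst w) (fun p => g p - snd w) 0 r 0 (2 * PI))
    as (A & m & HA); [lra|lra| |].
  { intros p Hp. destruct (Hc p Hp).
    repeat split; try (apply continuous_Rminus; auto; apply continuous_const).
    intros [? ?]. apply Hno. exists p. repeat split; try apply Hp; lra. }
  assert (Cid : forall u, continuity_pt (fun v => v) u)
    by (intros u; apply derivable_continuous_pt, derivable_pt_id).
  assert (Ccst : forall c u, continuity_pt (fun _ => c) u)
    by (intros c u; apply continuity_pt_const; intros ? ?; reflexivity).
  assert (CA1 : forall rho t, 0 <= rho <= r -> 0 <= t <= 2 * PI ->
    continuity_pt (fun u => A (u, t)) rho).
  { intros q t H1 H2. apply (continuity_pt_path A (fun v => v) (fun _ => t)); auto.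
    now apply HA. }
  assert (CA2 : forall rho t, 0 <= rho <= r -> 0 <= t <= 2 * PI ->
    continuity_pt (fun u => A (rho, u)) t).
  { intros q t H1 H2. apply (continuity_pt_path A (fun _ => q) (fun v => v)); auto.
    now apply HA. }
  assert (Same : forall p q, in_rect 0 r 0 (2 * PI) p -> in_rect 0 r 0 (2 * PI) q ->
    f p = f q -> g p = g q -> cos (A p - A q) = 1).
  { intros p q Hp Hq E1 E2. destruct (HA p Hp) as (_ & M1 & F1 & G1).
    destruct (HA q Hq) as (_ & M2 & F2 & G2).
    apply (same_direction (m p) (m q)); congruence. }
  assert (D0 : A (0, 2 * PI) - A (0, 0) = A (0, 0) - A (0, 0)).
  { symmetry. apply (constant_of_cos_eq_1 (fun u => A (0, u) - A (0, 0)) 0 (2 * PI)); [lra|].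
    intros u Hu. split; [apply continuity_pt_minus; [apply CA2; lra|auto]|].
    destruct (Hcst u Hu). apply Same; auto; split; simpl; lra. }
  (* The increment of the argument around the circle is a multiple of [2 PI] that depends
     continuously on the radius, and it is zero for the constant curve at radius 0. *)
  assert (D1 : A (r, 2 * PI) = A (r, 0)).
  { enough (A (0, 2 * PI) - A (0, 0) = A (r, 2 * PI) - A (r, 0)) by lra.
    apply (constant_of_cos_eq_1 (fun u => A (u, 2 * PI) - A (u, 0)) 0 r); [lra|].
    intros u Hu. split; [apply continuity_pt_minus; apply CA1; lra|].
    destruct (Hper u Hu). apply Same; auto; split; simpl; lra. }
  set (B := fun t => A (r, t)).
  assert (CB : forall t, 0 <= t <= 2 * PI -> continuity_pt B t)
    by (intros t Ht; apply CA2; lra).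
  assert (HB : forall t, 0 <= t <= 2 * PI -> 0 < m (r, t) /\
    x t - fst w = m (r, t) * cos (B t) /\ y t - snd w = m (r, t) * sin (B t)).
  { intros t Ht. destruct (HA (r, t)) as (_ & M & F1 & G1); [split; simpl; lra|].
    destruct (Hbd t Ht) as [<- <-]. auto. }
  (* A maximum at [2 * PI] is moved to 0, which leaves room on the right of [t0] for the step
     [h]. *)
  assert (Hmax : exists t0, 0 <= t0 < 2 * PI /\ forall t, 0 <= t <= 2 * PI -> B t <= B t0).
  { destruct (continuity_ab_maj B 0 (2 * PI)) as [t1 [M1 Ht1]]; [lra|exact CB|].
    destruct (Req_dec t1 (2 * PI)) as [E|E].
    - assert (EB : B t1 = B 0) by (rewrite E; exact D1).
      exists 0. split; [lra|]. intros t Ht. rewrite <- EB. now apply M1.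
    - exists t1. split; [lra|exact M1]. }
  destruct Hmax as (t0 & Ht0 & Hmax).
  (* [B] is known only to be continuous, so its growth is read from [phi], the component of
     [Gamma - w] normal to the direction [B t0]. It is differentiable and, for angles within [PI] of
     [B t0], has the sign of [B t - B t0]. *)
  set (phi := fun t => cos (B t0) * (y t - snd w) - sin (B t0) * (x t - fst w)).
  assert (Hphi : forall t, 0 <= t <= 2 * PI -> phi t = m (r, t) * sin (B t - B t0)).
  { intros t Ht. destruct (HB t Ht) as (_ & E1 & E2).
    unfold phi. rewrite E1, E2, sin_minus. ring. }
  set (l := rho t0 * sin (theta t0 - B t0)).
  assert (Dphi : is_derive phi t0 l).
  { unfold l. rewrite sin_minus.
    replace (rho t0 * _) with
      (cos (B t0) * (rho t0 * sin (theta t0)) - sin (B t0) * (rho t0 * cos (theta t0))) by ring.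
    apply (is_derive_minus (K := R_AbsRing) (V := R_NormedModule)
      (fun t => cos (B t0) * (y t - snd w)) (fun t => sin (B t0) * (x t - fst w))).
    - apply is_derive_scal.
      replace (rho t0 * sin (theta t0)) with (rho t0 * sin (theta t0) - 0) by ring.
      apply (is_derive_minus (K := R_AbsRing) (V := R_NormedModule) y); [apply L|].
      apply (is_derive_const (K := R_AbsRing) (V := R_NormedModule)).
    - apply is_derive_scal.
      replace (rho t0 * cos (theta t0)) with (rho t0 * cos (theta t0) - 0) by ring.
      apply (is_derive_minus (K := R_AbsRing) (V := R_NormedModule) x); [apply L|].
      apply (is_derive_const (K := R_AbsRing) (V := R_NormedModule)). }
  assert (Hl : 0 < l).
  { apply Rmult_lt_0_compat; [apply L|].
    assert (Hh := Hw t0). unfold height in Hh.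
    destruct (HB t0) as (M & E1 & E2); [lra|].
    replace (cos (theta t0) * (snd w - y t0) - sin (theta t0) * (fst w - x t0)) with
      (m (r, t0) * sin (theta t0 - B t0)) in Hh.
    - nra.
    - rewrite sin_minus.
      replace (snd w - y t0) with (- (m (r, t0) * sin (B t0))) by lra.
      replace (fst w - x t0) with (- (m (r, t0) * cos (B t0))) by lra. ring. }
  apply is_derive_Reals in Dphi.
  destruct (Dphi l Hl) as [d1 Hd1].
  assert (CB0 : continuity_pt B t0) by (apply CB; lra).
  apply continuity_pt_locally with (eps := mkposreal _ HPI) in CB0.
  destruct CB0 as [d2 Hd2]. simpl in Hd2.
  assert (P1 := cond_pos d1). assert (P2 := cond_pos d2).
  set (h := Rmin (Rmin d1 d2) (2 * PI - t0) / 2).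
  assert (Hh : 0 < h /\ h < d1 /\ h < d2 /\ h < 2 * PI - t0).
  { assert (Q1 := Rmin_l (Rmin d1 d2) (2 * PI - t0)).
    assert (Q2 := Rmin_r (Rmin d1 d2) (2 * PI - t0)).
    assert (Q3 := Rmin_l d1 d2). assert (Q4 := Rmin_r d1 d2).
    assert (0 < Rmin (Rmin d1 d2) (2 * PI - t0)) by (repeat apply Rmin_pos; lra).
    unfold h. lra. }
  destruct Hh as (h0 & h1 & h2 & h3).
  assert (K1 : Rabs ((phi (t0 + h) - phi t0) / h - l) < l).
  { apply Hd1; [lra|]. rewrite Rabs_pos_eq; lra. }
  assert (K2 : Rabs (B (t0 + h) - B t0) < PI).
  { apply Hd2. change (Rabs (t0 + h - t0) < d2).
    replace (t0 + h - t0) with h by ring. rewrite Rabs_pos_eq; lra. }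
  apply Rabs_def2 in K1. apply Rabs_def2 in K2.
  assert (Z : phi t0 = 0).
  { rewrite Hphi by lra. replace (B t0 - B t0) with 0 by ring. rewrite sin_0. ring. }
  rewrite Z, Rminus_0_r in K1.
  assert (K3 : 0 < phi (t0 + h)).
  { assert (E : phi (t0 + h) = phi (t0 + h) / h * h) by (field; lra).
    rewrite E. apply Rmult_lt_0_compat; lra. }
  rewrite Hphi in K3 by lra.
  assert (K4 := Hmax (t0 + h)).
  assert (K5 : 0 <= sin (B t0 - B (t0 + h))) by (apply sin_ge_0; lra).
  replace (B t0 - B (t0 + h)) with (- (B (t0 + h) - B t0)) in K5 by ring.
  rewrite sin_neg in K5. destruct (HB (t0 + h)) as (M & _); [lra|]. nra.
Qed.

(** * Images of disks bounded by such curves *)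

Lemma image_disk_eq_interior (Phi : C -> C) (r : R) :
  0 < r ->
  (forall z, Cmod z <= r -> @continuous C_UniformSpace C_UniformSpace Phi z) ->
  (forall z w, Cmod z <= r -> Cmod w <= r -> Phi z = Phi w -> z = w) ->
  (forall t, Phi (RtoC r * cis t)%C = (x t, y t)) ->
  forall w, image Phi (disk r) w <-> loop_interior w.
Proof.
  intros Hr Hc Hinj Hbd.
  assert (Hcov : forall w, loop_interior w -> image Phi (disk r) w).
  { intros w Hw.
    destruct (homotopy_covers_interior
      (fun p => fst (Phi (RtoC (fst p) * cis (snd p))%C))
      (fun p => snd (Phi (RtoC (fst p) * cis (snd p))%C)) r w) as ([q t] & [Hq Ht] & E1 & E2).
    - lra.
    - exact Hw.
    - intros [q t] [Hq Ht]. cbn [fst snd] in *.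
      assert (K : @continuous (prod_UniformSpace R_UniformSpace R_UniformSpace) C_UniformSpace
        (fun p : R * R => Phi (RtoC (fst p) * cis (snd p))%C) (q, t)).
      { apply (continuous_comp (V := C_UniformSpace)
          (fun p : R * R => (RtoC (fst p) * cis (snd p))%C) Phi).
        - apply continuous_polar.
        - apply Hc. cbn [fst snd]. rewrite Cmod_polar; lra. }
      split.
      + apply (continuous_comp (V := C_UniformSpace) _ fst _ K).
        apply (@continuous_fst R_UniformSpace R_UniformSpace).
      + apply (continuous_comp (V := C_UniformSpace) _ snd _ K).
        apply (@continuous_snd R_UniformSpace R_UniformSpace).
    - intros t _. cbn [fst snd]. now rewrite Hbd.
    - intros q _. cbn [fst snd]. unfold cis. now rewrite cos_2PI, sin_2PI, cos_0, sin_0.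
    - intros t _. cbn [fst snd]. now rewrite !Cmult_0_l.
    - cbn [fst snd] in *. exists (RtoC q * cis t)%C.
      assert (E : Phi (RtoC q * cis t)%C = w)
        by (rewrite (surjective_pairing w), <- E1, <- E2; apply surjective_pairing).
      split; [|exact E]. unfold disk. rewrite Cmod_polar by lra.
      destruct (Req_dec q r) as [->|]; [|lra].
      exfalso. rewrite Hbd in E. subst w. specialize (Hw t). rewrite height_self in Hw. lra. }
  intros w. split; [|apply Hcov].
  intros [z2 [Hz2 Ew]] t. apply Rnot_le_lt. intros Hle.
  destruct loop_interior_nonempty as [w1 Hw1].
  destruct (Hcov w1 Hw1) as [z1 [Hz1 Ew1]].
  destruct (functional_choice _ height_min_exists) as [T HT].
  set (zeta := fun s : R => (z1 + RtoC s * (z2 - z1))%C).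
  assert (Hzeta : forall s, 0 <= s <= 1 -> Cmod (zeta s) < r).
  { intros s Hs. unfold zeta.
    replace (z1 + RtoC s * (z2 - z1))%C with (RtoC (1 - s) * z1 + RtoC s * z2)%C
      by (rewrite RtoC_minus; ring).
    eapply Rle_lt_trans; [apply Cmod_triangle|].
    rewrite !Cmod_mult, !Cmod_R, !Rabs_pos_eq by lra.
    unfold disk in Hz1, Hz2. destruct (Req_dec s 0) as [->|]; nra. }
  assert (Czeta : forall s, @continuous R_UniformSpace C_UniformSpace zeta s).
  { intros s. unfold zeta, Cplus, Cmult, RtoC; cbn [fst snd].
    assert (Cs : @continuous R_UniformSpace R_UniformSpace (fun u => u) s) by apply continuous_id.
    apply (@continuous_Rpair R_UniformSpace); apply (@continuous_Rplus R_UniformSpace);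
      try apply continuous_const.
    - apply (@continuous_Rminus R_UniformSpace); apply (@continuous_Rmult R_UniformSpace);
        auto; apply continuous_const.
    - apply (@continuous_Rplus R_UniformSpace); apply (@continuous_Rmult R_UniformSpace);
        auto; apply continuous_const. }
  (* [M s] is the smallest height of the image point over all tangents. The choice [T] of a
     minimizing tangent may jump; [M] is continuous all the same, since each minimizer can be tested
     at the neighbouring point. *)
  set (M := fun s => height (T (Phi (zeta s))) (Phi (zeta s))).
  assert (CM : forall s, 0 <= s <= 1 -> continuity_pt M s).
  { intros s Hs. apply continuity_pt_locally. intros eps.
    assert (He : 0 < eps / 2) by (assert (V := cond_pos eps); lra).
    assert (K : @continuous R_UniformSpace C_UniformSpace (fun u => Phi (zeta u)) s).
    { apply continuous_comp; [apply Czeta|]. apply Hc. assert (V := Hzeta s Hs). lra. }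
    apply filterlim_locally with (eps := mkposreal _ He) in K.
    revert K. apply filter_imp. intros u [B1 B2].
    set (a := Phi (zeta u)) in *. set (b := Phi (zeta s)) in *.
    change (Rabs (fst a - fst b) < eps / 2) in B1.
    change (Rabs (snd a - snd b) < eps / 2) in B2.
    change (Rabs (height (T a) a - height (T b) b) < eps).
    assert (L1 := height_lipschitz (T a) b a). assert (L2 := height_lipschitz (T b) b a).
    assert (L3 := HT a (T b)). assert (L4 := HT b (T a)).
    assert (J1 : Rabs (height (T a) a - height (T a) b) < eps) by lra.
    assert (J2 : Rabs (height (T b) a - height (T b) b) < eps) by lra.
    apply Rabs_def2 in J1. apply Rabs_def2 in J2. apply Rabs_def1; lra. }
  assert (Z0 : zeta 0 = z1) by (unfold zeta; ring).
  assert (Z1 : zeta 1 = z2) by (unfold zeta; ring).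
  destruct (f_interv_is_interv (fun s => - M s) 0 1 0) as [s [Hs E]].
  - lra.
  - unfold M. rewrite Z0, Z1, Ew1, Ew. assert (K1 := Hw1 (T w1)). assert (K2 := HT w t). lra.
  - intros s Hs. apply continuity_pt_opp. now apply CM.
  - set (t0 := T (Phi (zeta s))).
    assert (E0 : height t0 (Phi (zeta s)) = 0) by (unfold t0; fold (M s); lra).
    assert (Hon : Phi (zeta s) = (x t0, y t0)).
    { apply height_zero_on_curve; [|exact E0].
      intros u. rewrite <- E0. apply HT. }
    rewrite <- Hbd in Hon. assert (Hlt := Hzeta s Hs).
    apply Hinj in Hon; [|lra|rewrite Cmod_polar; lra].
    rewrite Hon, Cmod_polar in Hlt; lra.
Qed.

Lemma image_disk_convex_region (Phi : C -> C) (r : R) :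
  0 < r ->
  (forall z, Cmod z <= r -> @continuous C_UniformSpace C_UniformSpace Phi z) ->
  (forall z w, Cmod z <= r -> Cmod w <= r -> Phi z = Phi w -> z = w) ->
  (forall t, Phi (RtoC r * cis t)%C = (x t, y t)) ->
  convex_region (image Phi (disk r)).
Proof.
  intros Hr Hc Hinj Hbd.
  assert (E := image_disk_eq_interior Phi r Hr Hc Hinj Hbd).
  repeat split.
  - destruct loop_interior_nonempty as [w Hw]. exists w. now apply E.
  - apply (open_ext loop_interior); [intros w; symmetry; apply E|apply loop_interior_open].
  - intros w1 w2 s H1 H2 Hs. apply E. apply E in H1. apply E in H2.
    replace (_ + _)%C with
      (((1 - s) * fst w1 + s * fst w2, (1 - s) * snd w1 + s * snd w2) : C).
    + now apply loop_interior_convex.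
    + unfold Cplus, Cmult, RtoC; cbn [fst snd]. f_equal; ring.
Qed.

End ConvexLoop.

(** * Continuity and differentiation of complex-valued maps *)

Lemma continuous_Cplus {U : UniformSpace} (f g : U -> C) (p : U) :
  @continuous U C_UniformSpace f p -> @continuous U C_UniformSpace g p ->
  @continuous U C_UniformSpace (fun q => (f q + g q)%C) p.
Proof.
  intros Hf Hg.
  apply (@continuous_plus U R_AbsRing C_R_NormedModule f g p); assumption.
Qed.

Lemma continuous_Re {U : UniformSpace} (f : U -> C) (p : U) :
  @continuous U C_UniformSpace f p -> continuous (fun q => fst (f q)) p.
Proof.
  intros Hf. apply (continuous_comp f fst _ Hf).
  destruct (f p). apply (@continuous_fst R_UniformSpace R_UniformSpace).
Qed.

Lemma continuous_Im {U : UniformSpace} (f : U -> C) (p : U) :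
  @continuous U C_UniformSpace f p -> continuous (fun q => snd (f q)) p.
Proof.
  intros Hf. apply (continuous_comp f snd _ Hf).
  destruct (f p). apply (@continuous_snd R_UniformSpace R_UniformSpace).
Qed.

Lemma continuous_Cmult {U : UniformSpace} (f g : U -> C) (p : U) :
  @continuous U C_UniformSpace f p -> @continuous U C_UniformSpace g p ->
  @continuous U C_UniformSpace (fun q => (f q * g q)%C) p.
Proof.
  intros Hf Hg.
  assert (H1 := continuous_Re f p Hf). assert (H2 := continuous_Im f p Hf).
  assert (H3 := continuous_Re g p Hg). assert (H4 := continuous_Im g p Hg).
  apply (@continuous_Rpair U).
  - now apply continuous_Rminus; apply continuous_Rmult.
  - now apply continuous_Rplus; apply continuous_Rmult.
Qed.

Lemma continuous_Cconj {U : UniformSpace} (f : U -> C) (p : U) :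
  @continuous U C_UniformSpace f p ->
  @continuous U C_UniformSpace (fun q => Cconj (f q)) p.
Proof.
  intros Hf. apply (@continuous_Rpair U); [now apply continuous_Re|].
  apply (@continuous_opp U R_AbsRing R_NormedModule). now apply continuous_Im.
Qed.

Lemma continuous_Cmod (z : C) : @continuous C_UniformSpace R_UniformSpace Cmod z.
Proof.
  assert (H := @continuous_id C_UniformSpace z).
  assert (H1 := continuous_Re (fun q => q) z H). assert (H2 := continuous_Im (fun q => q) z H).
  apply (continuous_R_comp (fun q : C_UniformSpace => fst q ^ 2 + snd q ^ 2) sqrt).
  - simpl. apply continuous_Rplus; apply continuous_Rmult; auto;
      apply continuous_Rmult; auto; apply continuous_const.
  - apply continuity_pt_sqrt. assert (V1 := pow2_ge_0 (fst z)). assert (V2 := pow2_ge_0 (snd z)).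
    lra.
Qed.

Lemma open_disk (r : R) : @open C_UniformSpace (disk r).
Proof.
  intros z Hz. exact (continuous_Cmod z (fun u => u < r) (open_lt r _ Hz)).
Qed.

(** Complex differentiability uses the neighbourhoods given by the modulus on the domain, the
    topological part those of the product structure; [locally_C] identifies them. *)
Lemma analytic_continuous (f : C -> C) (z : C) :
  analytic f -> disk 1 z -> @continuous C_UniformSpace C_UniformSpace f z.
Proof.
  intros Hf Hz.
  assert (H := ex_derive_continuous f z (Hf z Hz)).
  intros P HP. apply locally_C. now apply H.
Qed.

Lemma continuous_Lambda (p : nat) (lambda : nat -> C) (z : C) :
  @continuous C_UniformSpace C_UniformSpace (Lambda p lambda) z.
Proof.
  assert (Ht : forall k, @continuous C_UniformSpace C_UniformSpace
    (fun w => (lambda k * RtoC (Cmod w ^ (2 * (k - 1))))%C) z).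
  { intros k. apply continuous_Cmult; [apply continuous_const|].
    apply (@continuous_Rpair C_UniformSpace); [|apply continuous_const].
    apply (continuous_R_comp (U := C_UniformSpace) Cmod (fun u => u ^ (2 * (k - 1))));
      [apply continuous_Cmod|].
    apply derivable_continuous_pt, derivable_pt_pow. }
  unfold Lambda. induction p as [|p IH].
  - apply (@continuous_ext C_UniformSpace C_UniformSpace (fun _ => RtoC 0)).
    + intros w. rewrite sum_n_m_zero by lia. reflexivity.
    + apply continuous_const.
  - eapply (@continuous_ext C_UniformSpace C_UniformSpace).
    + intros w. symmetry. apply (sum_n_Sm (G := C_AbelianMonoid)). lia.
    + apply (continuous_Cplus (U := C_UniformSpace)); [exact IH|apply Ht].
Qed.

Lemma log_branch_continuous (G logG : C -> C) (z : C) :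
  log_branch G logG -> disk 1 z -> @continuous C_UniformSpace C_UniformSpace logG z.
Proof.
  intros (g1 & g2 & l1 & l2 & _ & _ & _ & _ & H1 & H2 & H) Hz.
  apply (continuous_ext_loc (T := C_UniformSpace) (U := C_UniformSpace) _
           (fun w => (l1 w + Cconj (l2 w))%C)).
  - generalize (open_disk 1 z Hz).
    apply filter_imp. intros w Hw. symmetry. now apply H.
  - apply (continuous_Cplus (U := C_UniformSpace)); [|apply (continuous_Cconj (U := C_UniformSpace))];
      now apply analytic_continuous.
Qed.

Lemma is_derive_Re (g : R -> C) (t : R) (v : C) :
  @is_derive R_AbsRing C_R_NormedModule g t v -> is_derive (fun s => fst (g s)) t (fst v).
Proof.
  intros H. unfold is_derive in *.
  apply (filterdiff_ext_lin _ (fun y => fst (scal (V := C_R_NormedModule) y v))); [|reflexivity].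
  apply (filterdiff_comp' (V := C_R_NormedModule) g fst); [exact H|].
  apply filterdiff_linear, is_linear_fst.
Qed.

Lemma is_derive_Im (g : R -> C) (t : R) (v : C) :
  @is_derive R_AbsRing C_R_NormedModule g t v -> is_derive (fun s => snd (g s)) t (snd v).
Proof.
  intros H. unfold is_derive in *.
  apply (filterdiff_ext_lin _ (fun y => snd (scal (V := C_R_NormedModule) y v))); [|reflexivity].
  apply (filterdiff_comp' (V := C_R_NormedModule) g snd); [exact H|].
  apply filterdiff_linear, is_linear_snd.
Qed.

(** * The image of a circle as a convex loop *)

Lemma Cpolar_form (c : C) : c <> RtoC 0 -> exists beta, c = (RtoC (Cmod c) * cis beta)%C.
Proof.
  intros Hc. assert (Hm : 0 < Cmod c) by now apply Cmod_gt_0.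
  assert (E : Cmod c ^ 2 = fst c ^ 2 + snd c ^ 2).
  { unfold Cmod. rewrite pow2_sqrt; [reflexivity|].
    assert (V1 := pow2_ge_0 (fst c)). assert (V2 := pow2_ge_0 (snd c)). lra. }
  destruct (unit_vector_angle (fst c / Cmod c) (snd c / Cmod c)) as [beta [H1 H2]].
  { replace (_ + _) with ((fst c ^ 2 + snd c ^ 2) / Cmod c ^ 2) by (field; lra).
    rewrite <- E. field. lra. }
  exists beta. unfold cis. rewrite <- H1, <- H2.
  rewrite (surjective_pairing c) at 1. unfold Cmult, RtoC; cbn [fst snd].
  f_equal; field; lra.
Qed.

Lemma cis_injective_period (s t : R) : s < t < s + 2 * PI -> cis t <> cis s.
Proof.
  intros H E. injection E as E1 E2. assert (HPI := PI_RGT_0).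
  destruct (cos_eq_1_2PI (t - s)) as [k Hk].
  { apply (same_direction 1 1); lra. }
  assert (0 < k)%Z by (apply lt_IZR; nra). assert (k < 1)%Z by (apply lt_IZR; nra). lia.
Qed.

(** Multiplication by [c] turns every tangent by the argument [beta] of [c] and scales the speed by
    its modulus, so the tangent angle still increases. Simplicity comes from the injectivity of
    [Phi]. *)
Lemma affine_convex_loop (Psi Phi : C -> C) (k c : C) (r : R) :
  0 < r < 1 -> convex_mapping Psi -> univalent Phi -> c <> RtoC 0 ->
  (forall t, Phi (RtoC r * cis t)%C = (k + c * Psi (RtoC r * cis t))%C) ->
  exists x y theta rho, convex_loop x y theta rho /\
    forall t, Phi (RtoC r * cis t)%C = (x t, y t).
Proof.
  intros Hr Hconv Huniv Hc HPhi.
  destruct (Hconv r Hr) as (v & theta & Hv).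
  destruct (Cpolar_form c Hc) as [beta Hbeta].
  assert (Hm : 0 < Cmod c) by now apply Cmod_gt_0.
  exists (fun t => fst (Phi (RtoC r * cis t)%C)), (fun t => snd (Phi (RtoC r * cis t)%C)),
    (fun t => theta t + beta), (fun t => Cmod c * Cmod (v t)).
  split; [|intros t; apply surjective_pairing].
  assert (Dpsi : forall t,
    is_derive (fun s => fst (Psi (RtoC r * cis s)%C)) t (Cmod (v t) * cos (theta t)) /\
    is_derive (fun s => snd (Psi (RtoC r * cis s)%C)) t (Cmod (v t) * sin (theta t))).
  { intros t. destruct (Hv t) as (Hd & _ & Ev & _).
    assert (E1 : fst (v t) = Cmod (v t) * cos (theta t)).
    { rewrite Ev at 1. unfold cis, Cmult, RtoC; cbn [fst snd]. ring. }
    assert (E2 : snd (v t) = Cmod (v t) * sin (theta t)).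
    { rewrite Ev at 1. unfold cis, Cmult, RtoC; cbn [fst snd]. ring. }
    rewrite <- E1, <- E2. split; [now apply is_derive_Re|now apply is_derive_Im]. }
  assert (Ec : fst c = Cmod c * cos beta /\ snd c = Cmod c * sin beta).
  { rewrite Hbeta at 1 3. unfold cis, Cmult, RtoC; cbn [fst snd]. split; ring. }
  destruct Ec as [Ec1 Ec2].
  assert (Hth : forall t, is_derive theta t (Derive theta t)).
  { intros t. apply Derive_correct. apply Hv. }
  split.
  - intros t. destruct (Dpsi t) as [D1 D2].
    apply (is_derive_ext (fun s => fst k +
      (fst c * fst (Psi (RtoC r * cis s)%C) - snd c * snd (Psi (RtoC r * cis s)%C)))).
    { intros s. rewrite HPhi. reflexivity. }
    rewrite cos_plus.
    replace (_ * _) with (0 + (fst c * (Cmod (v t) * cos (theta t))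
                               - snd c * (Cmod (v t) * sin (theta t))))
      by (rewrite Ec1, Ec2; ring).
    apply (is_derive_plus (K := R_AbsRing) (V := R_NormedModule));
      [apply (is_derive_const (K := R_AbsRing) (V := R_NormedModule))|].
    apply (is_derive_minus (K := R_AbsRing) (V := R_NormedModule)); now apply is_derive_scal.
  - intros t. destruct (Dpsi t) as [D1 D2].
    apply (is_derive_ext (fun s => snd k +
      (fst c * snd (Psi (RtoC r * cis s)%C) + snd c * fst (Psi (RtoC r * cis s)%C)))).
    { intros s. rewrite HPhi. reflexivity. }
    rewrite sin_plus.
    replace (_ * _) with (0 + (fst c * (Cmod (v t) * sin (theta t))
                               + snd c * (Cmod (v t) * cos (theta t))))
      by (rewrite Ec1, Ec2; ring).
    apply (is_derive_plus (K := R_AbsRing) (V := R_NormedModule));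
      [apply (is_derive_const (K := R_AbsRing) (V := R_NormedModule))|].
    apply (is_derive_plus (K := R_AbsRing) (V := R_NormedModule)); now apply is_derive_scal.
  - intros t. apply Rmult_lt_0_compat; [exact Hm|]. apply Cmod_gt_0, Hv.
  - intros t. apply continuity_pt_plus;
      [|apply continuity_pt_const; intros ? ?; reflexivity].
    exact (is_derive_continuity_pt _ _ _ (Hth t)).
  - intros s t Hst.
    enough (theta s < theta t) by lra.
    apply (derive_pos_increasing theta (Derive theta)); auto.
    intros u _. apply Hv.
  - intros t. unfold cis. now rewrite cos_plus, sin_plus, cos_2PI, sin_2PI,
      !Rmult_0_r, !Rmult_1_r, Rminus_0_r, Rplus_0_r.
  - intros t. unfold cis. now rewrite cos_plus, sin_plus, cos_2PI, sin_2PI,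
      !Rmult_0_r, !Rmult_1_r, Rminus_0_r, Rplus_0_r.
  - intros s t Hst [E1 E2]. apply (cis_injective_period s t Hst).
    assert (E : (RtoC r * cis t)%C = (RtoC r * cis s)%C).
    { apply Huniv; try (unfold disk; rewrite Cmod_polar; lra).
      rewrite (surjective_pairing (Phi (RtoC r * cis t)%C)), E1, E2.
      symmetry; apply surjective_pairing. }
    injection E as F1 F2. unfold cis in *. cbn [fst snd] in *. f_equal; nra.
Qed.

Theorem theorem5
  (p : nat) (hp : (1 <= p)%nat)
  (G logG : C -> C)
  (hG : log_harmonic G) (hG0 : nonvanishing G) (hlogG : log_branch G logG)
  (lambda : nat -> C)
  (f h : C -> C)
  (hf : constant_function f) (hf0 : nonvanishing f)
  (hh : constant_function h) (hh0 : nonvanishing h)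
  (logf logh : C)
  (hlogf : forall z, disk 1 z -> Cexp logf = f z)
  (hlogh : forall z, disk 1 z -> Cexp logh = h z)
  (F logF : C -> C)
  (hF : forall z, disk 1 z ->
     F z = (f z * h (Cconj z) *
            Cprod p (fun k =>
              Gpow logG z (lambda k * RtoC (Cmod z ^ (2 * (k - 1))))))%C)
  (hlogF : forall z, disk 1 z ->
     logF z = (logf + logh + Lambda p lambda z * logG z)%C)
  (hFuniv : univalent logF)
  (hGuniv : univalent logG)
  (hGconv : convex_mapping logG)
  (hL : forall z, disk 1 z -> z <> RtoC 0 -> Lop logG z <> RtoC 0)
  (hLambda : forall z, disk 1 z -> z <> RtoC 0 -> Lambda p lambda z <> RtoC 0) :
  forall r : R, 0 < r <= sqrt 2 - 1 ->
    convex_region (image logF (disk r)).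
Proof.
  intros r Hr.
  (* Since [sqrt 2 < 2], the closed disk of radius [r] lies in the open unit disk, where the
     assumptions on [logF] hold. *)
  assert (Hr1 : 0 < r < 1).
  { assert (sqrt 2 < 2).
    { rewrite <- (sqrt_pow2 2) at 2 by lra. apply sqrt_lt_1; lra. }
    lra. }
  assert (Hdisk : forall z, Cmod z <= r -> disk 1 z) by (intros z Hz; unfold disk; lra).
  (* The constant value of [Lambda] on the circle is read off at the real point [r], which is
     nonzero. *)
  destruct (affine_convex_loop logG logF (logf + logh)%C (Lambda p lambda (RtoC r)) r)
    as (x & y & theta & rho & L & Hbd); auto.
  { apply hLambda; [apply Hdisk; rewrite Cmod_R, Rabs_pos_eq; lra|].
    intros E. apply RtoC_inj in E. lra. }
  { intros t. rewrite hlogF by (apply Hdisk; rewrite Cmod_polar; lra).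
    unfold Lambda. rewrite Cmod_polar, Cmod_R, Rabs_pos_eq by lra. reflexivity. }
  apply (image_disk_convex_region L); [lra| | |exact Hbd].
  - intros z Hz. apply Hdisk in Hz.
    (* The formula for [logF] is given on the open unit disk only, so it is transferred through a
       neighbourhood of [z]. *)
    apply (continuous_ext_loc (T := C_UniformSpace) (U := C_UniformSpace) _
             (fun w => (logf + logh + Lambda p lambda w * logG w)%C)).
    + generalize (open_disk 1 z Hz).
      apply filter_imp. intros w Hw. symmetry. now apply hlogF.
    + apply (continuous_Cplus (U := C_UniformSpace)); [apply continuous_const|].
      apply (continuous_Cmult (U := C_UniformSpace)); [apply continuous_Lambda|].
      now apply (log_branch_continuous G).
  - intros z w Hz Hw. apply hFuniv; auto.
Qed.
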